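(* Let $p$ be a prime and let $G=G_1\amalg_A G_2$ be a proper amalgamated free pro-$p$ product of pro-$p$ groups, and assume that $A\lneq G_i$ for $i=1,2$. Then $G$ is boundedly generated if and only if $A$ is boundedly generated and $p=[G_1:A]=[G_2:A]=2$.
   Context: A profinite group $G$ is boundedly generated if there are finitely many $g_1,\dots,g_d\in G$ with $G=\overline{\langle g_1\rangle}\cdots\overline{\langle g_d\rangle}$ (equivalently, $G$ is a finite product of procyclic subgroups). For pro-$p$ groups $G_1,G_2$ with a specified common closed subgroup $A$, $G_1\amalg_A G_2$ denotes the pushout of $G_1\leftarrow A\rightarrow G_2$ in the category of pro-$p$ groups and continuous homomorphisms. It is called proper if the canonical maps $G_i\to G_1\amalg_A G_2$ are injective for $i=1,2$; then $G_1,G_2,A$ are identified with their images. *)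

(* Defs.v *)
From HB Require Import structures.
From mathcomp Require Import all_boot.
From mathcomp Require Import boolp classical_sets functions cardinality.
From mathcomp Require Import topology.

Set Implicit Arguments.
Unset Strict Implicit.
Unset Printing Implicit Defensive.

Local Open Scope classical_set_scope.
Local Open Scope card_scope.
Local Open Scope group_scope.

HB.mixin Record isTopologicalGroup G of Group G & Topological G := {
  mulg_continuous : continuous (fun xy : G * G => xy.1 * xy.2) ;
  invg_continuous : continuous (fun x : G => x^-1)
}.

#[short(type="topologicalGroupType")]
HB.structure Definition TopologicalGroup :=
  {G of isTopologicalGroup G & Group G & Topological G}.

Section Subgroups.
Variable G : topologicalGroupType.
Implicit Types (N : set G) (g : G).

Definition normal_subgroup N : Prop :=
  group_closed [in N] /\ forall x y : G, N x -> N (x ^ y).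

Definition left_cosets N : set (set G) :=
  range (fun x : G => [set x * h | h in N]).

Definition has_index N (n : nat) : Prop := left_cosets N #= `I_n.

Definition closed_cycle g : set G :=
  closure [set x | exists n : nat, x = g ^+ n \/ x = g ^- n].

End Subgroups.

(* The case d = 0 only adds the trivial group, which is also obtained from
   d = 1 with generator 1. *)
Definition boundedly_generated (G : topologicalGroupType) : Prop :=
  exists (d : nat) (g : 'I_d -> G), forall x : G,
  exists2 h : 'I_d -> G,
    forall i, closed_cycle (g i) (h i) & x = \prod_(i < d) h i.

Definition profinite (G : topologicalGroupType) : Prop :=
  [/\ compact [set: G], hausdorff_space G & totally_disconnected [set: G]].

Definition pro_p (p : nat) (G : topologicalGroupType) : Prop :=
  profinite G /\
  forall N : set G, open N -> normal_subgroup N ->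
    exists k : nat, has_index N (p ^ k)%N.

Definition continuous_hom (G H : topologicalGroupType) (f : G -> H) : Prop :=
  monoid_morphism f /\ continuous f.

Definition pro_p_pushout (p : nat) (A G1 G2 G : topologicalGroupType)
    (i1 : A -> G1) (i2 : A -> G2) (j1 : G1 -> G) (j2 : G2 -> G) : Prop :=
  [/\ pro_p p G,
      continuous_hom j1,
      continuous_hom j2,
      j1 \o i1 = j2 \o i2 &
      forall (H : topologicalGroupType) (f1 : G1 -> H) (f2 : G2 -> H),
        pro_p p H -> continuous_hom f1 -> continuous_hom f2 ->
        f1 \o i1 = f2 \o i2 ->
        exists! f : G -> H,
          [/\ continuous_hom f, f \o j1 = f1 & f \o j2 = f2]].

(* The common subgroup is given by a group A with embeddings i1 and i2.  An
   injective continuous homomorphism of profinite groups is a homeomorphism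
   onto a closed subgroup, because its source is compact and its target is
   Hausdorff. *)
Definition proper_amalgam (p : nat) (A G1 G2 G : topologicalGroupType)
    (i1 : A -> G1) (i2 : A -> G2) (j1 : G1 -> G) (j2 : G2 -> G) : Prop :=
  [/\ [/\ pro_p p A, pro_p p G1 & pro_p p G2],
      continuous_hom i1 /\ injective i1,
      continuous_hom i2 /\ injective i2,
      pro_p_pushout p i1 i2 j1 j2 &
      injective j1 /\ injective j2].

(* Main.v *)
Require Import Defs.
From HB Require Import structures.
From mathcomp Require Import all_boot all_fingroup all_solvable all_algebra.
From mathcomp Require Import ssrAC zify.

(** Both directions are decided on finite quotients. A pro-p group has enough of
    them: a point outside a closed set is separated from it by a continuous
    homomorphism to a finite p-group ([finite_separation]). If G is a product of
    d procyclic subgroups, every finite image of G is a product of d cyclic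
    groups, so its order is at most the d-th power of its exponent
    ([index_prod_cycles]).

    The indices. Let P1, P2 and B be the images of G1, G2 and A in a finite
    p-group, and let R be the group generated by P1 and P2. Replacing P2 by its
    conjugate under an element m that centralizes B, in an elementary abelian
    group M extended by R, gives a compatible pair of maps again, hence by the
    pushout property a new finite image R' of G. If M contains the permutation
    module on R/B, with m its basis vector at B, then the kernel K of R' -> R
    contains the first homology over F_p of the graph with edges R/B and vertices R/P1 and R/P2, on which the abstract
    amalgam of P1 and P2 acts; so |K| >= p^(|R:B| - |R:P1| - |R:P2|)
    ([card_conj_twist], [twisted_amalgam]). The indices of B in P1 and P2 do not
    change, and unless both are 2, this power of p has an exponent of at least a
    constant fraction of |R|. Iterating, the orders of the images of G grow like a
    tower, while the exponents of these groups are only multiplied by p at each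
    step; this contradicts the bound above ([amalgam_quotient_index]). So both
    indices are 2, and p = 2 ([index_two]).

    The group A. It remains to see that a closed subgroup of a boundedly
    generated pro-2 group is boundedly generated, which is a quantitative form of
    the theorem of Lazard, Lubotzky and Mann that boundedly generated pro-p groups
    have finite rank. Let a finite 2-group G be a product of d cyclic groups, and
    let N be generated by the 2^(l+1)-th powers, with (l + 3) d <= 2^l. The order
    bound controls N modulo its fourth powers, and 2^l-th powers centralize
    every small normal section of exponent 2; hence N is powerful, of bounded index
    and with boundedly many generators ([Mho_powerful]). Squaring induces surjections
    between the successive factors of the chain N, N^2, N^4, ..., so a subgroup A
    of N needs new generators along this chain only as often as its factors grow or
    those of N drop: in total at most as many as N ([subgroup_powerful_cycles]).
    So all subgroups of G are products of D(d) cyclic groups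
    ([subgroup_prod_cycles]), and compactness of A^D gives generators that work
    in all finite quotients at once ([closed_subgroup_boundedly_generated]).

    Conversely, if A has index 2 on both sides and x, y represent the other cosets,
    then A is normal and G/A is generated by two involutions, so that
    G = cl<xy> A cl<x>; this is checked in the finite quotients
    ([gen_two_index2_sub], [amalgam_boundedly_generated]). *)

Set Implicit Arguments.
Unset Strict Implicit.
Unset Printing Implicit Defensive.

(** * Products of cyclic subgroups *)

Section ProductsOfCycles.
Local Open Scope group_scope.
Variable gT : finGroupType.
Implicit Types (G H K N A B : {group gT}) (s : seq gT).

(** The factors are multiplied in the order of the list: the groups need not
    commute, and the product is in general only a set. *)
Definition prod_cycles (s : seq gT) : {set gT} := \prod_(g <- s) <[g]>.

Lemma prod_cycles_cons g s : prod_cycles (g :: s) = <[g]> * prod_cycles s.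
Proof. by rewrite /prod_cycles big_cons. Qed.

Lemma prod_cycles_cat s t : prod_cycles (s ++ t) = prod_cycles s * prod_cycles t.
Proof. by rewrite /prod_cycles big_cat. Qed.

Lemma prod_cycles1 s : 1 \in prod_cycles s.
Proof.
elim: s => [|g s IHs]; first by rewrite /prod_cycles big_nil set11.
by rewrite prod_cycles_cons -[1]mulg1 mem_mulg ?group1.
Qed.

Lemma mem_prod_cycles g s : g \in s -> g \in prod_cycles s.
Proof.
elim: s => // h s IHs; rewrite inE prod_cycles_cons => /orP[/eqP->|/IHs gs].
  by rewrite -{1}[h]mulg1 mem_mulg ?cycle_id ?prod_cycles1.
by rewrite -[g]mul1g mem_mulg ?group1.
Qed.

Lemma prod_cycles_sub s G : {subset s <= G} -> prod_cycles s \subset G.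
Proof.
elim: s => [|g s IHs] sG; first by rewrite /prod_cycles big_nil sub1G.
rewrite prod_cycles_cons mul_subG ?cycle_subG ?sG ?mem_head //.
by apply: IHs => x xs; apply: sG; rewrite inE xs orbT.
Qed.

Lemma card_mulset_leq (X Y : {set gT}) : #|X * Y| <= #|X| * #|Y|.
Proof. by rewrite [_ * _]curry_imset2X -cardsX leq_imset_card. Qed.

Lemma card_prod_cycles s m :
  (forall g, g \in s -> #[g] <= m) -> #|prod_cycles s| <= m ^ size s.
Proof.
elim: s => [|g s IHs] sm; first by rewrite /prod_cycles big_nil cards1.
rewrite prod_cycles_cons (leq_trans (card_mulset_leq _ _)) // expnS leq_mul //.
  by rewrite sm ?mem_head.
by apply: IHs => x xs; apply: sm; rewrite inE xs orbT.
Qed.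
End ProductsOfCycles.

Section QuotientsOfProducts.
Local Open Scope group_scope.

Lemma quotient_prod_cycles (gT : finGroupType) (K : {group gT}) (s : seq gT) :
  {subset s <= 'N(K)} -> prod_cycles s / K = prod_cycles (map (coset K) s).
Proof.
elim: s => [|g s IHs] sN; first by rewrite /prod_cycles !big_nil quotient1.
have gN : g \in 'N(K) by apply: sN; rewrite mem_head.
rewrite /= !prod_cycles_cons quotientMl ?cycle_subG // quotient_cycle // IHs //.
by move=> x xs; apply: sN; rewrite inE xs orbT.
Qed.

(** Modulo K every factor has at most q elements. *)
Lemma index_prod_cycles (gT : finGroupType) (G K : {group gT}) s q :
    prod_cycles s = G -> K <| G -> 0 < q ->
  (forall x, x \in G -> x ^+ q \in K) -> #|G : K| <= q ^ size s.
Proof.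
move=> defG /andP[_ nKG] q_gt0 GqK.
have sG : {subset s <= G} by move=> g gs; rewrite -defG mem_prod_cycles.
rewrite -card_quotient // -defG quotient_prod_cycles; last first.
  by move=> g gs; rewrite (subsetP nKG) ?sG.
rewrite -(size_map (coset K) s) card_prod_cycles // => _ /mapP[g gs ->].
rewrite dvdn_leq // order_dvdn -morphX ?(subsetP nKG) ?sG //=.
by rewrite coset_id ?GqK ?sG.
Qed.

(** Over F_2 one has g^(2^l) - 1 = (g - 1)^(2^l) as endomorphisms of E, and g - 1
    is nilpotent of order at most 2^l because E is a module of dimension at most 2^l
    under a 2-group. In multiplicative form, g - 1 is the map x |-> [~ x, g]. *)
Lemma expg_pow2_cent_normal (gT : finGroupType) (G E : {group gT}) l :
    2.-group G -> E <| G -> (forall x, x \in E -> x ^+ 2 = 1) ->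
    #|E| <= 2 ^ (2 ^ l) ->
  forall g, g \in G -> g ^+ (2 ^ l) \in 'C(E).
Proof.
move=> pG nEG E2 cardE g gG.
have commE x y : x \in E -> y \in G -> [~ x, y] \in E.
  by move=> xE yG; rewrite groupM ?groupV // memJ_norm // (subsetP (normal_norm nEG)).
have iterE k x : x \in E ->
    [~ x, g ^+ (2 ^ k)] = iter (2 ^ k) (fun y => [~ y, g]) x.
  elim: k x => [|k IHk] x xE //.
  rewrite expnS mul2n -addnn iterD -!IHk ?commE ?groupX //.
  rewrite expgnDr commgMJ; set u := [~ _, _].
  have uE : u \in E by rewrite commE ?groupX.
  by rewrite -[u ^ _](mulKVg u) mulgA -expg2 E2 // mul1g.
have nil r (F : {group gT}) x : F <| G -> #|F| <= 2 ^ r -> x \in F ->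
    iter r (fun y => [~ y, g]) x = 1.
  elim: r F x => [|r IHr] F x nFG cardF xF.
    by move: xF; rewrite (card_le1_trivg cardF) => /set1P.
  have [F1 | ntF] := eqVneq (F : {set gT}) 1.
    move: xF; rewrite F1 => /set1P ->.
    by elim: (r.+1) => //= k ->; rewrite comm1g.
  have sFG := normal_sub nFG; have nFG' := normal_norm nFG.
  have FG : [~: F, G] \proper F.
    by apply: (nil_comm_properl (pgroup_nil pG)); rewrite // subsetI subxx.
  rewrite iterSr (IHr [~: F, G]%G) ?mem_commg //.
    by rewrite /normal comm_subG // normsR // normG.
  rewrite -leq_double -mul2n -[(_.*2)%N]mul2n -expnS.
  have dvd : #|[~: F, G]| %| #|F| by rewrite cardSg ?proper_sub.
  apply: leq_trans cardF; rewrite -(LagrangeI F [~: F, G]) mulnC.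
  rewrite (setIidPr (proper_sub FG)) leq_mul // indexg_gt1.
  by case/andP: FG.
apply/centP => x xE; apply/esym/commgP/eqP.
by rewrite iterE // (nil _ E).
Qed.

(** A maximal subgroup M of K that contains H is normal of index p, so K = M <[x]> for
    every x outside M; induct on the index. *)
Lemma mulg_prod_cyclic (gT : finGroupType) (p : nat) (H K : {group gT}) c :
    prime p -> p.-group K -> H \subset K -> #|K : H| = (p ^ c)%N ->
  exists t, [/\ size t = c, {subset t <= K} & H * prod_cycles t = K].
Proof.
move=> p_pr; elim: c K => [|c IHc] K pK sHK indK.
  exists [::]; rewrite /prod_cycles big_nil mulg1; split=> //.
  by apply/eqP; rewrite eqEsubset sHK -indexg_eq1 indK.
have [defK | [M maxM sHM]] := maximal_exists sHK.
  have : (p ^ 0 < p ^ c.+1)%N by rewrite ltn_exp2l ?prime_gt1.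
  by rewrite -indK defK indexgg.
have [sMK nMK] := andP (p_maximal_normal pK maxM).
have indM : #|M : H| = (p ^ c)%N.
  have := Lagrange_index sMK sHM; rewrite (p_maximal_index pK maxM) indK expnS => /eqP.
  by rewrite eqn_pmul2l ?prime_gt0 // => /eqP.
have [t [szt stM defM]] := IHc M (pgroupS sMK pK) sHM indM.
have [_ [x xK xM]] := properP (maxgroupp maxM).
exists (rcons t x); rewrite size_rcons szt; split=> //.
  by move=> y; rewrite mem_rcons inE => /predU1P[-> // | /stM/(subsetP sMK)].
rewrite -cats1 prod_cycles_cat mulgA defM /prod_cycles big_seq1.
have sxK : <[x]> \subset K by rewrite cycle_subG.
rewrite -norm_joinEr ?(subset_trans sxK) //.
have sMxK : M <*> <[x]> \subset K by rewrite join_subG sMK.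
apply: contraNeq xM => neMxK; rewrite -cycle_subG.
have <- : M <*> <[x]> = M; last exact: joing_subr.
apply: (maxgroupP maxM).2 => /=; last exact: joing_subl.
by rewrite properEneq neMxK.
Qed.
End QuotientsOfProducts.

(** * Powerful subgroups of bounded index in finite 2-groups *)

Section PowerfulMho.
Local Open Scope group_scope.

Lemma mem_Mho1 (gT : finGroupType) (N : {group gT}) x :
  2.-group N -> x \in N -> x ^+ 2 \in 'Mho^1(N).
Proof. by move=> pN xN; rewrite (Mho_p_elt 1 xN) // (mem_p_elt pN). Qed.

Lemma Mho1_subG (gT : finGroupType) (N K : {group gT}) :
  2.-group N -> (forall x, x \in N -> x ^+ 2 \in K) -> 'Mho^1(N) \subset K.
Proof.
move=> pN NK; rewrite (MhoE 1 pN) gen_subG.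
by apply/subsetP=> _ /imsetP[x xN ->]; apply: NK.
Qed.

(** Commutators of N are central involutions, so the squares of N are central
    and form an elementary abelian group E. For v = g^(2^l) both E and the
    factor N / E are centralized by v, whence [~ n, v ^+ 2] = [~ n, v] ^+ 2 = 1. The
    elements v ^+ 2 generate a group that contains N. *)
Lemma sqr_cent_abelian (gT : finGroupType) (G N : {group gT}) l :
    2.-group G -> N <| G -> N \subset 'Mho^l.+1(G) ->
    (forall x, x \in N -> x ^+ 4 = 1) -> #|N| <= 2 ^ (2 ^ l) ->
    (forall a b, a \in N -> b \in N -> [~ a, b] ^+ 2 = 1) ->
    [~: N, N] \subset 'C(N) ->
  abelian N.
Proof.
move=> pG nNG sNM N4 cardN R2 cRN; have [sNG nNG'] := andP nNG.
have pN := pgroupS sNG pG.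
set E := 'Mho^1(N)%G.
have sEN : E \subset N := Mho_sub 1 N.
have cEN : E \subset 'C(N).
  apply: Mho1_subG => // a aN; apply/centP => b bN; apply/commgP.
  rewrite commXg ?R2 //; apply: esym; apply: (centsP cRN) => //.
  exact: mem_commg.
have abE : abelian E by rewrite /abelian (subset_trans cEN) // centS.
have E2 x : x \in E -> x ^+ 2 = 1.
  have: E \subset Group (group_Ldiv 2 abE).
    apply: Mho1_subG => // a aN; rewrite !inE mem_Mho1 //= -expgnA.
    by rewrite N4.
  by move=> sE /(subsetP sE); rewrite !inE => /andP[_ /eqP].
have nEG : E <| G by exact: gFnormal_trans.
have nEG' := normal_norm nEG.
have cardE : #|E| <= 2 ^ (2 ^ l) by rewrite (leq_trans (subset_leq_card sEN)).
suff cGN g : g \in G -> g ^+ (2 ^ l.+1) \in 'C(N).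
  rewrite /abelian (subset_trans sNM) // (MhoE _ pG) gen_subG.
  by apply/subsetP=> _ /imsetP[x xG ->]; apply: cGN.
move=> gG; set v := g ^+ (2 ^ l).
have vG : v \in G by rewrite groupX.
have vE : v \in 'C(E) by apply: (expg_pow2_cent_normal pG).
have vNE n : n \in N -> [~ n, v] \in E.
  move=> nN; have nNE : n \in 'N(E) by rewrite (subsetP nEG') ?(subsetP sNG).
  have vN : v \in 'N(E) by rewrite (subsetP nEG').
  apply: coset_idr; rewrite ?groupR // morphR //; apply/eqP/commgP.
  have: coset E g ^+ (2 ^ l) \in 'C(N / E).
    apply: (@expg_pow2_cent_normal _ (G / E) (N / E)).
    - exact: quotient_pgroup.
    - exact: quotient_normal.
    - move=> _ /morphimP[x xnE xN ->]; rewrite -morphX //=.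
      by rewrite coset_id ?mem_Mho1.
    - by rewrite (leq_trans (leq_quotient _ _)).
    - by rewrite mem_quotient.
  rewrite -morphX ?(subsetP nEG') // => /centP cvN.
  by apply: esym; apply: cvN; rewrite mem_quotient.
apply/centP => n nN; apply/esym/commgP.
rewrite expnSr expgnA expg2 commgMJ.
have cuv : [~ n, v] ^ v = [~ n, v].
  by apply/conjg_fixP/commgP; apply/esym; apply: (centP vE); apply: vNE.
by rewrite cuv -expg2 E2 ?vNE.
Qed.

(** If N = 'Mho^(l+1)(G) had a nontrivial derived subgroup D, then J = 'Phi(D) [~: D, G]
    would be proper in D; modulo J, commutators of N are central involutions and
    [sqr_cent_abelian] makes N / J abelian, that is, D lies in J. *)
Lemma Mho_exp4_abelian (gT : finGroupType) (G : {group gT}) l :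
    2.-group G -> (forall x, x \in 'Mho^l.+1(G) -> x ^+ 4 = 1) ->
    #|'Mho^l.+1(G)| <= 2 ^ (2 ^ l) ->
  abelian 'Mho^l.+1(G).
Proof.
move=> pG N4 cardN; set N := 'Mho^l.+1(G)%G.
have nNG : N <| G := Mho_normal _ _.
have [sNG nNG'] := andP nNG; have pN := pgroupS sNG pG.
apply/commG1P/eqP/idPn => ntD.
set D := [~: N, N]%G in ntD *.
have nDG : D <| G by rewrite /normal normsR // andbT comm_subG.
have [sDG nDG'] := andP nDG; have pD := pgroupS sDG pG.
pose J := ('Phi(D) <*> [~: D, G])%G.
have sJD : J \subset D by rewrite join_subG Phi_sub commg_subl.
have nJG : J <| G.
  apply: normalY; first exact: gFnormal_trans.
  by rewrite /normal comm_subG // normsR // normG.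
have [sJG nJG'] := andP nJG.
have sDJ : D \subset J.
  rewrite -quotient_cents2 ?(subset_trans sNG) //.
  have -> : N / J = (N / J)%G by [].
  apply: (@sqr_cent_abelian _ (G / J) (N / J) l).
  - exact: quotient_pgroup.
  - exact: quotient_normal.
  - by rewrite /= /quotient -morphim_Mho.
  - move=> _ /morphimP[x xnJ xN ->]; rewrite -morphX //=.
    by rewrite N4 // morph1.
  - by rewrite (leq_trans (leq_quotient _ _)).
  - move=> _ _ /morphimP[x xnJ xN ->] /morphimP[y ynJ yN ->].
    rewrite -morphR // -morphX ?groupR //= coset_id //.
    rewrite (subsetP (joing_subl _ _)) // (Phi_joing pD).
    by rewrite (subsetP (joing_subr _ _)) // mem_Mho1 ?mem_commg.
  - rewrite -quotientR ?(subset_trans sNG) //.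
    apply: subset_trans (centS (quotientS J sNG)).
    by rewrite quotient_cents2 ?(subset_trans sDG) ?joing_subr.
have defD : 'Phi(D) <*> [~: D, G] = D by apply/eqP; rewrite eqEsubset sJD sDJ.
have := Phi_nongen defD; rewrite genGid => eqD.
have: [~: D, G] \proper D.
  by apply: (nil_comm_properl (pgroup_nil pG)); rewrite // subsetI subxx.
by rewrite eqD properxx.
Qed.

(** The conclusion says that N is powerful: for 2-groups, commutators have to lie
    in the group of fourth powers, here in the squares of the squares. *)
Lemma Mho_powerful (gT : finGroupType) (G : {group gT}) l (N := 'Mho^l.+1(G)) :
    2.-group G -> #|N : 'Mho^1('Mho^1(N))| <= 2 ^ (2 ^ l) ->
  [~: N, N] \subset 'Mho^1('Mho^1(N)).
Proof.
move=> pG; set M := 'Mho^1(_); have nNG : 'Mho^l.+1(G)%G <| G := Mho_normal _ _.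
have [sNG nNG'] := andP nNG; have pN := pgroupS sNG pG.
have nMG : M <| G by do 2!apply: gFnormal_trans.
have nMN : N \subset 'N(M) by rewrite (subset_trans sNG) ?normal_norm.
rewrite -card_quotient // -quotient_cents2 //= => cardNM.
have defNM : N / M = 'Mho^l.+1(G / M) by rewrite /quotient morphim_Mho ?normal_norm.
rewrite defNM; apply: Mho_exp4_abelian; first exact: quotient_pgroup.
  rewrite -defNM => _ /morphimP[x xnM xN ->]; rewrite -morphX //= coset_id //.
  rewrite (expgnA x 2 2) mem_Mho1 ?mem_Mho1 //.
  exact: pgroupS (Mho_sub _ _) pN.
by rewrite -defNM.
Qed.
End PowerfulMho.

(** * The chain of iterated squares of a powerful 2-group *)

Section SquaresChain.
Local Open Scope group_scope.

Definition iter_Mho1 (gT : finGroupType) (N : {group gT}) k : {group gT} :=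
  iter k (fun H : {group gT} => 'Mho^1(H)%G) N.

Arguments iter_Mho1 : simpl never.

Lemma iter_Mho1_char (gT : finGroupType) (N : {group gT}) k : iter_Mho1 N k \char N.
Proof.
elim: k => [|k IHk]; first exact: char_refl.
exact: char_trans (Mho_char 1 _) IHk.
Qed.

Lemma iter_Mho1S (gT : finGroupType) (N : {group gT}) k :
  iter_Mho1 N k.+1 \subset iter_Mho1 N k.
Proof. exact: Mho_sub. Qed.

Lemma iter_Mho1_sub (gT : finGroupType) (N : {group gT}) k : iter_Mho1 N k \subset N.
Proof. exact: char_sub (iter_Mho1_char N k). Qed.

Lemma iter_Mho1_norm (gT : finGroupType) (N : {group gT}) k : N \subset 'N(iter_Mho1 N k).
Proof. exact: char_norm (iter_Mho1_char N k). Qed.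

Lemma iter_Mho1_eventually1 (gT : finGroupType) (N : {group gT}) :
  2.-group N -> exists k, iter_Mho1 N k :=: 1.
Proof.
have [m] := ubnP #|N|; elim: m N => // m IHm N cardN pN.
have [N1 | ntN] := eqVneq (N : {set gT}) 1; first by exists 0.
have sMPhi : 'Mho^1(N) \subset 'Phi(N) by rewrite (Phi_joing pN) joing_subr.
have pM : 2.-group 'Mho^1(N) := pgroupS (Mho_sub 1 N) pN.
have [] := IHm 'Mho^1(N)%G _ pM.
  rewrite -ltnS (leq_trans _ cardN) // ltnS proper_card //.
  exact: sub_proper_trans sMPhi (Phi_proper ntN).
by move=> k; exists k.+1; rewrite /iter_Mho1 iterSr.
Qed.

Lemma Mho1_commg_sub (gT : finGroupType) (H N J : {group gT}) :
    2.-group H -> H \subset N -> N \subset 'N(J) ->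
    (forall a b, a \in H -> b \in N -> [~ a ^+ 2, b] \in J) ->
  [~: 'Mho^1(H), N] \subset J.
Proof.
move=> pH sHN nJN HJ.
have sMN : 'Mho^1(H) \subset N := subset_trans (Mho_sub 1 H) sHN.
rewrite -quotient_cents2 ?(subset_trans sMN) //.
rewrite sub_quotient_pre; last exact: subset_trans sMN nJN.
apply: (@Mho1_subG _ H (coset J @*^-1 'C(N / J))%G) => // a aH /=.
have aN : a ^+ 2 \in N by rewrite groupX ?(subsetP sHN).
rewrite mem_morphpre ?(subsetP nJN) //; apply/centP => _ /morphimP[b bnJ bN ->].
apply/commgP; rewrite -morphR ?(subsetP nJN) //=.
by rewrite coset_id ?HJ.
Qed.

(** Written with u ^+ 2 in front so that, in a filtration, the first factor goes one
    step down because it is a square and the second because it is a commutator. *)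
Lemma commg_sqr (gT : finGroupType) (a b : gT) (u := [~ a, b]) :
  [~ a ^+ 2, b] = u ^+ 2 * [~ u, a] ^ u.
Proof.
rewrite expg2 commMgJ -/u; move: u => v; rewrite [[~ v, a] ^ v]conjgE commgEl expg2.
by rewrite !mulgA mulgK mulgV mul1g conjgE !mulgA.
Qed.

(** Each N_k inherits the powerful condition from N_(k-1). With C = [~: N_(k+1), N],
    the identity for [~ a ^+ 2, b] shows first that [~: N_(k+2), N], then that C
    itself, lies in N_(k+3) [~: C, N]; as N is nilpotent, C lies in N_(k+3). *)
Lemma iter_Mho1_powerful (gT : finGroupType) (N : {group gT}) :
    2.-group N -> [~: N, N] \subset iter_Mho1 N 2 ->
  forall k, [~: iter_Mho1 N k, N] \subset iter_Mho1 N k.+2.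
Proof.
move=> pN N2; elim=> [|k IHk] //.
have pNk j : 2.-group (iter_Mho1 N j) := pgroupS (iter_Mho1_sub N j) pN.
set C := [~: iter_Mho1 N k.+1, N]%G; set L := iter_Mho1 N k.+3.
pose J := (L <*> [~: C, N])%G.
have sC2 : C \subset iter_Mho1 N k.+2.
  by apply: subset_trans IHk; rewrite commSg // iter_Mho1S.
have nCN : N \subset 'N(C) by rewrite normsR ?iter_Mho1_norm // normG.
have sCN : C \subset N := subset_trans sC2 (iter_Mho1_sub _ _).
have nJN : N \subset 'N(J) by rewrite normsY ?iter_Mho1_norm // normsR // normG.
have sq2 u : u \in iter_Mho1 N k.+2 -> u ^+ 2 \in J.
  by move=> u2; apply: (subsetP (joing_subl L [~: C, N])); apply: mem_Mho1 (pNk _) u2.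
have step2 : [~: iter_Mho1 N k.+2, N] \subset J.
  apply: (Mho1_commg_sub (pNk k.+1)); rewrite ?iter_Mho1_sub // => c a cN1 aN.
  have cN := subsetP (iter_Mho1_sub _ _) _ cN1.
  have uC : [~ c, a] \in C by rewrite mem_commg.
  have uN := subsetP sCN _ uC.
  rewrite commg_sqr groupM ?sq2 ?(subsetP sC2) //.
  by rewrite memJ_norm ?(subsetP nJN) // (subsetP (joing_subr _ _)) // mem_commg.
have sCJ : C \subset J.
  apply: (Mho1_commg_sub (pNk k)); rewrite ?iter_Mho1_sub // => a b aNk bN.
  have aN := subsetP (iter_Mho1_sub _ _) _ aNk.
  have u2 : [~ a, b] \in iter_Mho1 N k.+2 by rewrite (subsetP IHk) // mem_commg.
  have uN := subsetP (iter_Mho1_sub _ _) _ u2.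
  rewrite commg_sqr groupM ?sq2 //.
  by rewrite memJ_norm ?(subsetP nJN) // (subsetP step2) // mem_commg.
have nLN : N \subset 'N(L) := iter_Mho1_norm N _.
rewrite -quotient_sub1 ?(subset_trans sCN) //; apply: contraT => ntC.
have: [~: C / L, N / L] \proper C / L.
  apply: (@nil_comm_properl _ (N / L) (C / L)).
  - by apply: (@pgroup_nil _ 2); apply: quotient_pgroup.
  - exact: quotientS.
  - by rewrite -subG1.
  - by rewrite subsetI subxx quotient_norms.
rewrite -quotientR ?(subset_trans sCN) // properE => /andP[_ /negP[]].
have -> : [~: C, N] / L = J / L.
  have sCNN : [~: C, N] \subset N by rewrite comm_subG.
  by rewrite quotientYidl // (subset_trans sCNN).
exact: quotientS.
Qed.

(** At the stage H of the chain only the powers of the generators that lie in H count. *)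
Definition prod_cycles_in (gT : finGroupType) (s : seq gT) (H : {set gT}) : {set gT} :=
  \prod_(g <- s) (<[g]> :&: H).

Lemma prod_cycles_in_cons (gT : finGroupType) g s (H : {group gT}) :
  prod_cycles_in (g :: s) H = (<[g]> :&: H) * prod_cycles_in s H.
Proof. by rewrite /prod_cycles_in big_cons. Qed.

Lemma prod_cycles_in_cat (gT : finGroupType) s t (H : {group gT}) :
  prod_cycles_in (s ++ t) H = prod_cycles_in s H * prod_cycles_in t H.
Proof. by rewrite /prod_cycles_in big_cat. Qed.

Lemma prod_cycles_in_sub (gT : finGroupType) s (H : {group gT}) :
  prod_cycles_in s H \subset H.
Proof.
elim: s => [|g s IHs]; first by rewrite /prod_cycles_in big_nil sub1G.
by rewrite prod_cycles_in_cons mul_subG ?subsetIr.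
Qed.

Lemma prod_cycles_inE (gT : finGroupType) (s : seq gT) (H : {group gT}) :
  {subset s <= H} -> prod_cycles_in s H = prod_cycles s.
Proof.
move=> sH; apply: eq_big_seq => g gs.
by apply/setIidPl; rewrite cycle_subG sH.
Qed.

(** Factors that are central modulo K move left to the factor generated by the same
    element. *)
Lemma prod_cycles_absorb (gT : finGroupType) (s : seq gT) (N Z K : {group gT}) :
    {subset s <= N} -> Z \subset N -> K \subset N -> N \subset 'N(K) ->
    [~: Z, N] \subset K ->
  prod_cycles s * prod_cycles_in s Z \subset prod_cycles s * K.
Proof.
move=> + sZN sKN nKN cZN; elim: s => [|g s IHs] sN.
  by rewrite /prod_cycles_in /prod_cycles !big_nil mulgS ?sub1G.
have gN : g \in N by rewrite sN ?mem_head.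
have {}sN : {subset s <= N} by move=> x xs; rewrite sN // inE xs orbT.
rewrite prod_cycles_in_cons prod_cycles_cons.
apply/subsetP=> _ /mulsgP[_ _ /mulsgP[x y xg ys ->] /mulsgP[z w /setIP[zg zZ] ws ->] ->].
have yN : y \in N by apply: subsetP ys; rewrite prod_cycles_sub.
have wN : w \in N by rewrite (subsetP sZN) // (subsetP (prod_cycles_in_sub s Z)).
have /mulsgP[u k us kK defu] : y * w \in prod_cycles s * K.
  by rewrite (subsetP (IHs sN)) ?mem_mulg.
have -> : x * y * (z * w) = (x * z) * (u * (k * [~ y, z] ^ w)).
  rewrite [u * (_ * _)]mulgA -defu conjgE !mulgA mulgK -(mulgA x y z) (commgC y z).
  by rewrite !mulgA.
have cK : [~ y, z] ^ w \in K.
  by rewrite memJ_norm ?(subsetP nKN) // -groupV invgR (subsetP cZN) ?mem_commg.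
rewrite -[_ * _ * gval K]mulgA; apply: mem_mulg; first exact: groupM.
by apply: mem_mulg => //; apply: groupM.
Qed.
End SquaresChain.

(** * Subgroups of powerful 2-groups *)

Section RankOfSubgroups.
Local Open Scope group_scope.

Lemma leq_indexSg (gT : finGroupType) (A B C : {group gT}) :
  A \subset B -> #|A : C| <= #|B : C|.
Proof. by move=> sAB; rewrite subset_leq_card // imsetS. Qed.

(** The indices mean those of A :&: K and A :&: L in A, and the classes of A :&: L
    modulo A :&: K are among those of L modulo K. *)
Lemma leq_index_trans (gT : finGroupType) (A K L : {group gT}) :
  K \subset L -> #|A : K| <= #|A : L| * #|L : K|.
Proof.
move=> sKL; have sAK : A :&: K \subset A :&: L by rewrite setIS.
rewrite -(indexgI A K) -(indexgI A L) /= -(Lagrange_index (subsetIl A L) sAK).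
have -> : (A :&: K)%G = ((A :&: L) :&: K)%G.
  by apply: val_inj; rewrite /= -setIA (setIidPr sKL).
by rewrite !indexgI leq_mul // leq_indexSg ?subsetIr.
Qed.

Variables (gT : finGroupType) (N : {group gT}).
Hypothesis pN : 2.-group N.
Hypothesis powN : [~: N, N] \subset iter_Mho1 N 2.

Let pNk k : 2.-group (iter_Mho1 N k).
Proof. exact: pgroupS (iter_Mho1_sub N k) pN. Qed.

(** This is a homomorphism on N_k because N is powerful, and it maps N_k onto
    N_(k+1) / N_(k+2). *)
Definition sqr_coset k (x : gT) := coset (iter_Mho1 N k.+2) (x ^+ 2).

Lemma sqr_cosetM k : {in iter_Mho1 N k &, {morph sqr_coset k : x y / x * y}}.
Proof.
move=> x y xNk yNk; rewrite /sqr_coset.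
have nN := subsetP (iter_Mho1_norm N k.+2).
have [xN yN] : x \in N /\ y \in N by split; apply: (subsetP (iter_Mho1_sub N k)).
have cxy : commute (coset (iter_Mho1 N k.+2) x) (coset (iter_Mho1 N k.+2) y).
  apply/commgP; rewrite -morphR ?nN //= coset_id //.
  by rewrite (subsetP (iter_Mho1_powerful pN powN k)) // mem_commg.
by rewrite !morphX ?nN ?groupM //= morphM ?nN // expgMn.
Qed.
Canonical sqr_coset_morphism k := Morphism (@sqr_cosetM k).

Lemma sqr_coset_in k x : x \in iter_Mho1 N k -> x ^+ 2 \in iter_Mho1 N k.+1.
Proof. exact: mem_Mho1 (pNk k). Qed.

Lemma sqr_coset_im k : sqr_coset k @* iter_Mho1 N k = iter_Mho1 N k.+1 / iter_Mho1 N k.+2.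
Proof.
apply/eqP; rewrite eqEsubset; apply/andP; split.
  by apply/subsetP=> _ /morphimP[x _ xNk ->]; rewrite mem_quotient ?sqr_coset_in.
have nNk : iter_Mho1 N k.+1 \subset 'N(iter_Mho1 N k.+2).
  exact: subset_trans (iter_Mho1_sub _ _) (iter_Mho1_norm _ _).
rewrite sub_quotient_pre //.
apply: (@Mho1_subG _ (iter_Mho1 N k)
  (coset (iter_Mho1 N k.+2) @*^-1 (sqr_coset k @* iter_Mho1 N k))%G) => //.
move=> x xNk /=; rewrite mem_morphpre ?(subsetP nNk) ?sqr_coset_in //.
by apply/morphimP; exists x.
Qed.

Lemma sqr_coset1 k x : x \in iter_Mho1 N k.+1 -> sqr_coset k x = 1.
Proof. by move=> xN1; rewrite /sqr_coset coset_id // sqr_coset_in. Qed.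

(** The kernel of squaring on A_k / A_(k+1) embeds in its kernel on N_k / N_(k+1),
    whose order is the quotient of the orders of two successive factors of N. *)
Lemma index_sqr_coset_leq k (A : {group gT}) :
  (#|iter_Mho1 N k.+1 : iter_Mho1 N k.+2| * #|A :&: iter_Mho1 N k : iter_Mho1 N k.+1| <=
   #|iter_Mho1 N k : iter_Mho1 N k.+1| * #|sqr_coset k @* (A :&: iter_Mho1 N k)|)%N.
Proof.
set L := 'ker (sqr_coset_morphism k).
have sN1L : iter_Mho1 N k.+1 \subset L.
  apply/subsetP=> x xN1; apply/kerP; first exact: (subsetP (iter_Mho1S N k)).
  exact: sqr_coset1.
have sLN : L \subset iter_Mho1 N k := subsetIl _ _.
have nNk : iter_Mho1 N k.+1 \subset 'N(iter_Mho1 N k.+2).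
  exact: subset_trans (iter_Mho1_sub _ _) (iter_Mho1_norm _ _).
rewrite -(card_quotient nNk) -sqr_coset_im !card_morphim setIid.
rewrite (setIidPr (subsetIr A (iter_Mho1 N k))).
rewrite -(Lagrange_index sLN sN1L) -mulnA leq_pmul2l //.
rewrite mulnC; apply: leq_index_trans => //.
Qed.

Lemma sqr_prod_cycles_in k s x : x \in prod_cycles_in s (iter_Mho1 N k) ->
  exists2 y, y \in prod_cycles_in s (iter_Mho1 N k.+1) &
             sqr_coset k x = coset (iter_Mho1 N k.+2) y.
Proof.
have nN := subsetP (subset_trans (iter_Mho1_sub N k.+1) (iter_Mho1_norm N k.+2)).
elim: s x => [|g s IHs] x; rewrite ?prod_cycles_in_cons.
  rewrite /prod_cycles_in !big_nil => /set1P ->; exists 1; rewrite ?set11 //.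
  by rewrite sqr_coset1 ?group1 // morph1.
case/mulsgP=> [y z /setIP[yg yN] zs ->].
have [w ws sqz] := IHs z zs.
have zN : z \in iter_Mho1 N k := subsetP (prod_cycles_in_sub s _) _ zs.
exists (y ^+ 2 * w).
  by rewrite mem_mulg // inE groupX //= sqr_coset_in.
rewrite (sqr_cosetM yN zN) sqz morphM ?nN ?sqr_coset_in //.
exact: subsetP (prod_cycles_in_sub s _) _ ws.
Qed.

(** With N_k the chain and A_k = A :&: N_k, the second item is the count: in
    logarithms, the number of generators is at most dim N_0/N_1 - dim N_k/N_(k+1) +
    dim A_k/A_(k+1). In the step from k to k + 1 the squares of the old generators
    already span the image of A_k, and only a complement of this image in
    A_(k+1) / A_(k+2) has to be added; [index_sqr_coset_leq] preserves the count.
    The last item is needed to see that the old squares do span. *)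
Lemma subgroup_cycles_upto (A : {group gT}) k : A \subset N ->
  exists s, [/\ {subset s <= A},
    (2 ^ size s * #|iter_Mho1 N k : iter_Mho1 N k.+1| <=
       #|N : 'Mho^1(N)| * #|A :&: iter_Mho1 N k : iter_Mho1 N k.+1|)%N,
    A \subset prod_cycles s * iter_Mho1 N k.+1 &
    A :&: iter_Mho1 N k \subset prod_cycles_in s (iter_Mho1 N k) * iter_Mho1 N k.+1].
Proof.
move=> sAN; have pA := pgroupS sAN pN.
have nKN j : N \subset 'N(iter_Mho1 N j) := iter_Mho1_norm N j.
elim: k => [|k [s [sA cards defA defAk]]].
  have [c indA] := p_natP (pnat_dvd (dvdn_indexg A (A :&: iter_Mho1 N 1)) pA).
  have [t [szt tA defA]] := mulg_prod_cyclic (isT : prime 2) pA (subsetIl A _) indA.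
  have sAt : A \subset prod_cycles t * iter_Mho1 N 1.
    have nAt : prod_cycles t \subset 'N(A :&: iter_Mho1 N 1).
      apply: subset_trans (prod_cycles_sub tA) _.
      by rewrite normsI ?normG // (subset_trans sAN).
    by rewrite -{1}defA -(normC nAt) mulgS ?subsetIr.
  exists t; split => //; first by rewrite szt -indA indexgI (setIidPl sAN) mulnC.
  by rewrite (setIidPl sAN) prod_cycles_inE // => g /tA /(subsetP sAN).
set N1 := iter_Mho1 N k.+1; set N2 := iter_Mho1 N k.+2.
have nN2 : N1 \subset 'N(N2) := subset_trans (iter_Mho1_sub _ _) (nKN _).
set A1 := (A :&: N1)%G; set I := (sqr_coset k @* (A :&: iter_Mho1 N k))%G.
have pA1 : 2.-group A1 := pgroupS (subsetIl _ _) pA.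
have nN2A1 : A1 \subset 'N(N2) := subset_trans (subsetIr _ _) nN2.
(* H / N2 is the image of A_k under squaring, and t completes it to A_(k+1). *)
set H := (A1 :&: coset N2 @*^-1 I)%G.
have sIA : I \subset A1 / N2.
  apply/subsetP=> _ /morphimP[x _ /setIP[xA xN] ->].
  by rewrite mem_quotient // inE groupX //= sqr_coset_in.
have quoH : H / N2 = I by rewrite quotient_setIpre (setIidPr sIA).
have sHA : H \subset A1 := subsetIl _ _.
have [c indA] := p_natP (pnat_dvd (dvdn_indexg A1 H) pA1).
have [t [szt tA defA1]] := mulg_prod_cyclic (isT : prime 2) pA1 sHA indA.
have tN1 : {subset t <= N1} by move=> g /tA /setIP[].
have sA1 : A1 \subset prod_cycles_in s N1 * prod_cycles t * N2.
  rewrite -mulgA (normC (subset_trans (prod_cycles_sub tA) nN2A1)) mulgA.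
  rewrite -{1}defA1 mulSg //.
  apply/subsetP=> x /setIP[xA1 /morphpreP[_ /morphimP[a aNk aAk eqxa]]].
  have xN2 := subsetP nN2A1 x xA1.
  have /mulsgP[u z us zN1 defa] := subsetP defAk a aAk.
  have uNk := subsetP (prod_cycles_in_sub s _) u us.
  have [w ws equw] : exists2 w, w \in prod_cycles_in s N1 &
    sqr_coset k u = coset N2 w := sqr_prod_cycles_in us.
  have wN2 := subsetP nN2 _ (subsetP (prod_cycles_in_sub s _) w ws).
  rewrite -(mulKVg w x) mem_mulg // coset_idr ?groupM ?groupV //.
  rewrite morphM ?groupV // morphV //= -equw eqxa /= defa.
  have zNk := subsetP (iter_Mho1S N k) z zN1.
  by rewrite (sqr_cosetM uNk zNk) (sqr_coset1 zN1) mulg1 mulVg.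
exists (s ++ t); split.
- by move=> g; rewrite mem_cat => /orP[/sA // | /tA /setIP[]].
- rewrite -/N1 -/N2 -[#|A :&: N1 : N2|]/(#|A1 : N2|).
  have sNH : A1 :&: N2 \subset H.
    apply/subsetP=> x /setIP[xA1 xN2].
    rewrite inE xA1 /= mem_morphpre ?(subsetP nN2A1) //=.
    by rewrite coset_id // group1.
  have -> : #|A1 : N2| = (2 ^ c * #|I|)%N.
    rewrite -(indexgI A1 N2) /= -(Lagrange_index sHA sNH) indA; congr (_ * _)%N.
    have -> : (A1 :&: N2)%G = (H :&: N2)%G.
      apply: val_inj; apply/eqP; rewrite eqEsubset /= subsetI sNH subsetIr.
      by rewrite setSI // subsetIl.
    by rewrite indexgI -quoH card_quotient // (subset_trans sHA).
  rewrite size_cat szt expnD mulnAC [(2 ^ c * _)%N]mulnC mulnA leq_pmul2r ?expn_gt0 //.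
  have := index_sqr_coset_leq k A; rewrite -/N1 -/N2 => le1.
  rewrite -(leq_pmul2r (indexg_gt0 (A :&: iter_Mho1 N k)%G N1)).
  rewrite -(leq_pmul2r (indexg_gt0 (iter_Mho1 N k) N1)) /=.
  have := leq_mul cards le1.
  by rewrite [leqLHS](AC (2*2) (1*3*4*2)) [leqRHS](AC (2*2) (1*4*2*3)).
- have [sN sK2] : {subset s <= N} /\ N2 \subset N.
    by split; [move=> g /sA /(subsetP sAN) | apply: iter_Mho1_sub].
  have sK1 : N1 \subset N := iter_Mho1_sub _ _.
  have sAA1 : A \subset prod_cycles s * A1.
    apply/subsetP=> x xA; have /mulsgP[u y us yN1 defx] := subsetP defA x xA.
    rewrite defx mem_mulg // inE yN1 andbT -(mulKg u y) -defx groupM ?groupV //.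
    exact: subsetP (prod_cycles_sub sA) _ us.
  have nN2t : prod_cycles t \subset 'N(N2) := subset_trans (prod_cycles_sub tN1) nN2.
  apply: subset_trans sAA1 _; apply: subset_trans (mulgS _ sA1) _.
  have cN12 : [~: N1, N] \subset N2.
    exact: subset_trans (iter_Mho1_powerful pN powN k.+1) (iter_Mho1S N k.+2).
  have absorb := prod_cycles_absorb sN sK1 sK2 (nKN _) cN12.
  rewrite !mulgA (subset_trans (mulSg _ (mulSg _ absorb))) //.
  by rewrite prod_cycles_cat -!mulgA mulgS // (mulgA N2) -(normC nN2t) -mulgA mulGid.
by rewrite prod_cycles_in_cat (prod_cycles_inE tN1).
Qed.

(** At the end of the chain both last factors are trivial, and the count reads
    2 ^ size s <= #|N : 'Mho^1(N)|. *)
Lemma subgroup_powerful_cycles (A : {group gT}) : A \subset N ->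
  exists2 s, (2 ^ size s <= #|N : 'Mho^1(N)|)%N & prod_cycles s = A.
Proof.
move=> sAN; have [k Nk1] := iter_Mho1_eventually1 pN.
have [s [sA cards defA _]] := subgroup_cycles_upto k sAN.
have N11 : iter_Mho1 N k.+1 :=: 1 by apply/trivgP; rewrite -Nk1 iter_Mho1S.
exists s.
  have ind1 (B : {group gT}) : B \subset iter_Mho1 N k -> #|B : iter_Mho1 N k.+1| = 1%N.
    by rewrite Nk1 => sB1; apply/eqP; rewrite indexg_eq1 (subset_trans sB1) ?sub1G.
  move: cards; rewrite -[#|A :&: _ : _|]/#|A :&: iter_Mho1 N k : _|%G.
  by rewrite !ind1 ?subsetIr // !muln1.
by apply/eqP; rewrite eqEsubset prod_cycles_sub // (subset_trans defA) // N11 mulg1.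
Qed.
End RankOfSubgroups.

(** * Subgroups of products of cyclic 2-groups *)

Section BoundedProducts.
Local Open Scope group_scope.

Lemma double_leq_exp2 m : (2 * m <= 2 ^ m)%N.
Proof. by case: m => // m; rewrite expnS leq_mul2l ltn_expl. Qed.

Lemma exp2_dominates a b : exists l, (a * l + b <= 2 ^ l)%N.
Proof.
(* With l = 2 m, both factors of 2 ^ l are at least 2 m. *)
pose m := (a + b).+1; exists (2 * m)%N.
rewrite mul2n -addnn expnD.
apply: leq_trans (leq_mul (double_leq_exp2 m) (double_leq_exp2 m)).
by rewrite /m; nia.
Qed.

(** With l chosen so that (l + 3) d <= 2^l, the group N = 'Mho^(l+1)(G) is powerful,
    and A is built from A :&: N, which needs no more generators than N, and from a
    chain of cyclic steps of length log_2 #|A : A :&: N|. *)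
Lemma subgroup_prod_cycles d : exists D, forall (gT : finGroupType)
    (G A : {group gT}) (s : seq gT),
  2.-group G -> prod_cycles s = G -> size s <= d -> A \subset G ->
  exists2 t, size t <= D & prod_cycles t = A.
Proof.
(* The choice of l leaves room for the index of the fourth powers of N. *)
have [l le_l] := exp2_dominates d (3 * d).
exists ((l + 2) * d + (l + 1) * d)%N => gT G A s pG defG szs sAG.
set N := 'Mho^l.+1(G)%G; have nNG : N <| G := Mho_normal _ _.
have pN := pgroupS (normal_sub nNG) pG.
have pM : 2.-group 'Mho^1(N) := pgroupS (Mho_sub 1 N) pN.
have index_le k (K : {group gT}) : K <| G ->
    (forall x, x \in G -> x ^+ (2 ^ k) \in K) -> #|G : K| <= 2 ^ (k * d).
  move=> nKG GK; apply: leq_trans (index_prod_cycles defG nKG (expn_gt0 2 k) GK) _.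
  by rewrite -expnM leq_pexp2l // leq_mul2l szs orbT.
have powN x : x \in G -> x ^+ (2 ^ l.+1) \in N.
  by move=> xG; rewrite (Mho_p_elt _ xG) // (mem_p_elt pG).
have nMG : 'Mho^1(N) <| G by apply: gFnormal_trans.
have indM : #|N : 'Mho^1(N)| <= 2 ^ ((l + 2) * d).
  apply: leq_trans (leq_indexSg _ (normal_sub nNG)) _.
  apply: index_le => // x xG; rewrite addn2 expnSr expgnA.
  by rewrite mem_Mho1 ?powN.
have indMM : #|N : 'Mho^1('Mho^1(N))| <= 2 ^ (2 ^ l).
  apply: leq_trans (leq_indexSg _ (normal_sub nNG)) _.
  have: ((l + 3) * d <= 2 ^ l)%N by rewrite mulnDl mulnC.
  rewrite -(leq_exp2l _ _ (isT : 1 < 2)); apply: leq_trans.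
  apply: index_le => [|x xG]; first by apply: gFnormal_trans.
  by rewrite addn3 expnSr expgnA mem_Mho1 // expnSr expgnA mem_Mho1 ?powN.
have powerful := Mho_powerful pG indMM.
have [t1 sz1 defAN] := subgroup_powerful_cycles pN powerful (subsetIr A N).
have [c indA] := p_natP (pnat_dvd (dvdn_indexg A (A :&: N)) (pgroupS sAG pG)).
have [t2 [sz2 _ defA]] :=
  mulg_prod_cyclic (isT : prime 2) (pgroupS sAG pG) (subsetIl A N) indA.
exists (t1 ++ t2); last by rewrite prod_cycles_cat defAN.
rewrite size_cat leq_add //.
  by rewrite -(leq_exp2l _ _ (isT : 1 < 2)) (leq_trans sz1).
rewrite sz2 -(leq_exp2l _ _ (isT : 1 < 2)) -indA indexgI.
apply: leq_trans (leq_indexSg _ sAG) _.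
by rewrite addn1; apply: index_le.
Qed.
End BoundedProducts.

(** * Conjugating one factor of an amalgam *)

Section Twist.
Local Open Scope group_scope.

Lemma card_gen_abelem (gT : finGroupType) (p : nat) (M : {group gT}) (X : {set gT}) :
  prime p -> p.-abelem M -> X \subset M -> #|<<X>>| <= p ^ #|X|.
Proof.
move=> p_pr abelM sXM.
have abelX : p.-abelem <<X>> by rewrite (abelemS _ abelM) ?gen_subG.
rewrite (card_pgroup (abelem_pgroup abelX)) leq_exp2l ?prime_gt1 //.
by rewrite -(rank_abelem abelX) -grank_abelian ?grank_min ?(abelem_abelian abelX).
Qed.

Variables (gT : finGroupType) (p : nat) (M P1 P2 : {group gT}) (m : gT).
Let R := (P1 <*> P2)%G.
Let R' := (P1 <*> P2 :^ m)%G.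
Let K := (R' :&: M)%G.
Hypotheses (p_pr : prime p) (abelM : p.-abelem M).
Hypotheses (nMR : R \subset 'N(M)) (tiRM : R :&: M = 1) (mM : m \in M).

(** An element of P2 and its conjugate by m differ by an element of M. *)
Lemma twist_mul_sub : R' \subset R * M.
Proof.
rewrite -norm_joinEl // join_subG; apply/andP; split.
  by rewrite (subset_trans (joing_subl P1 P2)) ?joing_subl.
have mRM : m \in R <*> M by rewrite (subsetP (joing_subr _ _)).
rewrite -(conjGid mRM) conjSg.
by rewrite (subset_trans (joing_subr P1 P2)) ?joing_subl.
Qed.

Lemma twist_norm : R' \subset 'N(M).
Proof. by rewrite (subset_trans twist_mul_sub) // mul_subG ?normG. Qed.

Lemma sub_twist_mul : R \subset R' * M.
Proof.
rewrite -norm_joinEl ?twist_norm // join_subG; apply/andP; split.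
  by rewrite (subset_trans (joing_subl P1 (P2 :^ m))) ?joing_subl.
have mRM : m \in R' <*> M by rewrite (subsetP (joing_subr _ _)).
rewrite -(conjSg _ _ m) (conjGid mRM).
by rewrite (subset_trans (joing_subr P1 (P2 :^ m))) ?joing_subl.
Qed.

Lemma twist_card : #|R'| = (#|R| * #|K|)%N.
Proof.
have RM : R' / M = R / M.
  apply/eqP; rewrite eqEsubset -{1}(quotientMidr M R) -{2}(quotientMidr M R').
  by rewrite !quotientS ?twist_mul_sub ?sub_twist_mul.
have tiMR : M :&: R = 1 by rewrite setIC.
have -> : #|R| = #|R' / M| by rewrite RM; apply: card_isog (quotient_isog nMR tiMR).
rewrite card_quotient ?twist_norm //.
by rewrite -(indexgI R' M) mulnC Lagrange ?subsetIl.
Qed.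

Let twist_lift (q : gT) : gT := odflt 1 [pick r in R' | q^-1 * r \in M].

Lemma twist_liftP q : q \in R -> (twist_lift q \in R') /\ (q^-1 * twist_lift q \in M).
Proof.
move=> /(subsetP sub_twist_mul)/mulsgP[r x rR' xM ->].
rewrite /twist_lift; case: pickP => [s /andP[] // | /(_ r)].
by rewrite rR' invMg mulgKV groupV xM.
Qed.

(** Fix for every q in R a lift in R', and write it as q * del q with del q in M.
    Modulo K, lifts are unique; left multiplication by P1 shows that del is constant
    on the cosets P1 q, and left multiplication by P2 :^ m shows that
    eta q = m ^ q * del q is constant on the cosets P2 q. So all conjugates
    m ^ q = eta q * (del q)^-1 lie in the group generated by K and by
    #|R : P1| + #|R : P2| elements of M. *)
Lemma card_conj_twist :
  #|<<[set m ^ q | q in R]>>| <= #|K| * p ^ (#|R : P1| + #|R : P2|).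
Proof.
pose del q := q^-1 * twist_lift q.
pose eta q := q^-1 * m * twist_lift q.
pose X1 := [set del (repr C) | C in rcosets P1 R].
pose X2 := [set eta (repr C) | C in rcosets P2 R].
have repr_in (P : {group gT}) q : P \subset R -> q \in R ->
    exists2 x, x \in P & repr (P :* q) = x * q.
  by move=> sPR qR; case/rcosetP: (mem_repr_rcoset P q) => x xP ->; exists x.
have sP1R : P1 \subset R := joing_subl _ _.
have sP2R : P2 \subset R := joing_subr _ _.
have sP1R' : P1 \subset R' := joing_subl _ _.
have sP2R' : P2 :^ m \subset R' := joing_subr _ _.
have delM q : q \in R -> del q \in M by case/twist_liftP.
have etaE q : eta q = m ^ q * del q by rewrite /eta /del conjgE !mulgA mulgK.
have etaM q : q \in R -> eta q \in M.
  move=> qR; rewrite etaE groupM ?delM // memJ_norm //.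
  exact: subsetP nMR q qR.
have delK q : q \in R -> (del (repr (P1 :* q)))^-1 * del q \in K.
  move=> qR; have [x xP ->] := repr_in P1 q sP1R qR.
  have xqR : x * q \in R by rewrite groupM // (subsetP sP1R).
  apply/setIP; split; last by apply: groupM; rewrite ?groupV; apply: delM.
  have -> : (del (x * q))^-1 * del q = (twist_lift (x * q))^-1 * x * twist_lift q.
    by rewrite /del !invMg !invgK !mulgA mulgK.
  by rewrite !groupM ?groupV ?(twist_liftP _).1 // (subsetP sP1R').
have etaK q : q \in R -> (eta (repr (P2 :* q)))^-1 * eta q \in K.
  move=> qR; have [x xP ->] := repr_in P2 q sP2R qR.
  have xqR : x * q \in R by rewrite groupM // (subsetP sP2R).
  apply/setIP; split; last by apply: groupM; rewrite ?groupV; apply: etaM.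
  have -> : (eta (x * q))^-1 * eta q = (twist_lift (x * q))^-1 * (x ^ m) * twist_lift q.
    by rewrite /eta !invMg !invgK conjgE !mulgA mulgK.
  have xmR' : x ^ m \in R' by rewrite (subsetP sP2R') // memJ_conjg.
  by rewrite groupM ?(twist_liftP _).1 // groupM ?groupV ?(twist_liftP _).1.
have sX1M : X1 \subset M.
  apply/subsetP=> _ /imsetP[_ /rcosetsP[q qR ->] ->]; apply: delM.
  by have [x xP ->] := repr_in P1 q sP1R qR; rewrite groupM // (subsetP sP1R).
have sX2M : X2 \subset M.
  apply/subsetP=> _ /imsetP[_ /rcosetsP[q qR ->] ->]; apply: etaM.
  by have [x xP ->] := repr_in P2 q sP2R qR; rewrite groupM // (subsetP sP2R).
have cMM (Y Z : {group gT}) : Y \subset M -> Z \subset M -> Y <*> Z = Y * Z.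
  move=> sYM sZM; apply: cent_joinEl; apply: subset_trans sYM _.
  exact: subset_trans (abelem_abelian abelM) (centS sZM).
have sD : <<[set m ^ q | q in R]>> \subset K <*> (<<X1>> <*> <<X2>>).
  rewrite gen_subG; apply/subsetP=> _ /imsetP[q qR ->].
  pose Y := (K <*> (<<X1>> <*> <<X2>>))%G.
  suff: m ^ q \in Y by [].
  have sKY : K \subset Y := joing_subl _ _.
  have [sX1Y sX2Y] : X1 \subset Y /\ X2 \subset Y.
    have := joing_subr K (<<X1>> <*> <<X2>>).
    by rewrite join_subG !gen_subG => /andP[].
  have -> : m ^ q = eta q * (del q)^-1 by rewrite etaE mulgK.
  rewrite groupM ?groupV //.
    rewrite -(mulKVg (eta (repr (P2 :* q))) (eta q)) groupM //.
      apply: (subsetP sX2Y); apply/imsetP; exists (P2 :* q) => //.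
      by apply/rcosetsP; exists q.
    by rewrite (subsetP sKY) ?etaK.
  rewrite -(mulKVg (del (repr (P1 :* q))) (del q)) groupM //.
    apply: (subsetP sX1Y); apply/imsetP; exists (P1 :* q) => //.
    by apply/rcosetsP; exists q.
  by rewrite (subsetP sKY) ?delK.
apply: leq_trans (subset_leq_card sD) _.
have sKM : K \subset M := subsetIr _ _.
have [sY1 sY2] : <<X1>> \subset M /\ <<X2>> \subset M by rewrite !gen_subG.
have le_mul (Y Z : {group gT}) : #|Y * Z| <= #|Y| * #|Z|.
  by rewrite mul_cardG leq_pmulr ?cardG_gt0.
rewrite (cMM K (<<X1>> <*> <<X2>>)%G) ?join_subG ?sY1 //.
apply: leq_trans (le_mul _ _) _; rewrite leq_mul2l; apply/orP; right.
rewrite /= (cMM <<X1>>%G <<X2>>%G) //; apply: leq_trans (le_mul _ _) _.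
rewrite expnD leq_mul //.
  apply: leq_trans (card_gen_abelem p_pr abelM sX1M) _.
  by rewrite leq_exp2l ?prime_gt1 // leq_imset_card.
apply: leq_trans (card_gen_abelem p_pr abelM sX2M) _.
by rewrite leq_exp2l ?prime_gt1 // leq_imset_card.
Qed.
End Twist.

(** * Affine permutations over cosets *)

Section Affine.
Local Open Scope group_scope.
Variables (gT : finGroupType) (p : nat).
Hypothesis p_pr : prime p.
Local Notation V := {ffun {set gT} -> 'F_p}.
Local Notation W := {perm {set gT} * 'F_p}.

(** The wreath product of 'F_p by gT, realized by permutations: gT translates the
    subsets of itself, and an independent translation of 'F_p is added on each
    of them. All subsets are used, and not only cosets, so that gT acts faithfully. *)
Definition aff_fun (x : gT) (w : V) (t : {set gT} * 'F_p) : {set gT} * 'F_p :=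
  (t.1 :* x, (t.2 + w t.1)%R).

Lemma aff_fun_inj x w : injective (aff_fun x w).
Proof.
move=> [C c] [D d] eqt.
have /= eqCD := congr1 fst eqt; have /= eqcd := congr1 snd eqt.
have eqC : C = D by rewrite -(rcosetK x C) eqCD rcosetK.
by move: eqcd; rewrite eqC => eqcd; rewrite (GRing.addIr _ eqcd).
Qed.

Definition aff x w : W := perm (@aff_fun_inj x w).

Lemma affE x w C c : aff x w (C, c) = (C :* x, (c + w C)%R).
Proof. by rewrite permE. Qed.

Lemma affM x w y v :
  aff x w * aff y v = aff (x * y) [ffun C => w C + v (C :* x)]%R.
Proof.
by apply/permP => -[C c]; rewrite permM !affE rcosetM ffunE GRing.addrA.
Qed.

Lemma aff_inj x w y v : aff x w = aff y v -> x = y /\ w = v.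
Proof.
move=> eqa; have E C : (C :* x, w C) = (C :* y, v C).
  by have := congr1 (fun s : W => s (C, 0%R)) eqa; rewrite !affE !GRing.add0r.
split; last by apply/ffunP => C; have /= := congr1 snd (E C).
have /= := congr1 fst (E [set 1]); rewrite !mulg_set1 !mul1g => eqx.
by apply/set1P; rewrite -eqx set11.
Qed.

(** The elementary abelian base of the wreath product. *)
Definition shift w : W := aff 1 w.
Definition lin x : W := aff x 0%R.

Lemma linM : {morph lin : x y / x * y}.
Proof.
move=> x y; rewrite /lin affM; congr aff.
by apply/ffunP => C; rewrite !ffunE GRing.addr0.
Qed.
Canonical lin_morphism := @Morphism _ _ [set: gT] lin (in2W linM).

Lemma lin_inj : injective lin.
Proof. by move=> x y /aff_inj[]. Qed.

Lemma shiftM w v : shift w * shift v = shift (w + v)%R.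
Proof.
by rewrite /shift affM mulg1; congr aff; apply/ffunP=> C; rewrite !ffunE rcoset1.
Qed.

Lemma shift0 : shift 0%R = 1.
Proof. by apply/permP => -[C c]; rewrite affE perm1 rcoset1 ffunE GRing.addr0. Qed.

Lemma shift_inj : injective shift.
Proof. by move=> w v /aff_inj[]. Qed.

Lemma shift_conj w x :
  (shift w) ^ (lin x) = shift [ffun C => w (C :* x^-1)]%R.
Proof.
apply: (mulgI (lin x)); rewrite -conjgC /shift /lin !affM mul1g mulg1; congr aff.
by apply/ffunP=> C; rewrite !ffunE rcosetK GRing.addr0 GRing.add0r.
Qed.

Lemma shift_group_set : group_set [set shift w | w in [set: V]].
Proof.
apply/group_setP; split; first by apply/imsetP; exists 0%R; rewrite ?shift0 ?inE.
move=> _ _ /imsetP[w _ ->] /imsetP[v _ ->]; rewrite shiftM.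
by apply: imset_f; rewrite inE.
Qed.
Definition shifts := Group shift_group_set.

Lemma mem_shift w : shift w \in shifts.
Proof. by apply: imset_f; rewrite inE. Qed.

Lemma shiftX w n : shift w ^+ n = shift (w *+ n)%R.
Proof.
elim: n => [|n IHn]; first by rewrite GRing.mulr0n shift0.
by rewrite expgS IHn shiftM GRing.mulrS.
Qed.

Lemma shifts_abelem : p.-abelem shifts.
Proof.
rewrite abelemE //; apply/andP; split.
  apply/centsP => _ /imsetP[w _ ->] _ /imsetP[v _ ->].
  by rewrite /commute !shiftM GRing.addrC.
apply/exponentP => _ /imsetP[w _ ->]; rewrite shiftX -shift0; congr shift.
apply/ffunP=> C; rewrite ffunMnE ffunE -GRing.mulr_natr.
by rewrite (pchar_Fp_0 p_pr) GRing.mulr0.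
Qed.

Lemma lin_norm_shifts x : lin x \in 'N(shifts).
Proof.
rewrite inE; apply/subsetP => _ /imsetP[_ /imsetP[w _ ->] ->].
by rewrite shift_conj mem_shift.
Qed.

Lemma lin_shift_trivI x w : lin x = shift w -> x = 1.
Proof. by case/aff_inj. Qed.

Variables (B R : {group gT}).

(** The basis vector of the permutation module that belongs to the coset B itself; it is
    fixed by B, and its translates are the basis vectors of all cosets of B. *)
Definition bump_coset : V := [ffun C => ((C == B :> {set gT})%:R)]%R.

Lemma bump_coset_cent x : x \in B -> lin x ^ shift bump_coset = lin x.
Proof.
move=> xB; apply/conjg_fixP/commgP; rewrite /commute /lin /shift !affM mul1g mulg1.
congr aff; apply/ffunP=> C; rewrite !ffunE GRing.addr0 GRing.add0r.
by rewrite -(can_eq (rcosetK x) C) (rcoset_id xB).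
Qed.

Lemma card_bump_coset :
  p ^ #|R : B| <= #|<<[set shift bump_coset ^ lin q | q in R]>>|.
Proof.
set D := <<_>>.
pose F := pffun_on (0%R : 'F_p) (mem (rcosets B R)) predT.
have <- : #|F| = (p ^ #|R : B|)%N.
  by rewrite card_pffun_on /= card_Fp.
rewrite -(card_image shift_inj F); apply: subset_leq_card.
apply/subsetP => _ /imageP[w /pffun_onP[suppw _] ->].
have -> : w = (\sum_(C in rcosets B R) [ffun C' => (C' == C)%:R] *+ (w C : nat))%R.
  apply/ffunP=> C; rewrite sum_ffunE.
  have [CB|nCB] := boolP (C \in rcosets B R).
    rewrite (bigD1 C) //= ffunMnE ffunE eqxx natr_Zp.
    rewrite big1 ?GRing.addr0 // => C' /andP[_ neC].
    by rewrite ffunMnE ffunE eq_sym (negPf neC) GRing.mul0rn.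
  have -> : w C = 0%R.
    by apply/eqP; apply: contraNT nCB => wC; apply: (subsetP suppw).
  rewrite big1 // => C' C'B; rewrite ffunMnE ffunE.
  have /negPf -> : C != C' by apply: contraNneq nCB => ->.
  exact: GRing.mul0rn.
elim/big_ind: _ => [|v1 v2|C /rcosetsP[q qR ->]].
- by rewrite shift0 group1.
- by rewrite -shiftM => *; apply: groupM.
rewrite -shiftX groupX // mem_gen //; apply/imsetP; exists q => //.
rewrite shift_conj; congr shift; apply/ffunP=> X; rewrite !ffunE; congr (_%:R)%R.
by rewrite -(can_eq (rcosetK q)) rcosetKV.
Qed.
End Affine.

(** * Growth of the finite quotients of an amalgam *)

Section TwistedAmalgam.
Local Open Scope group_scope.

(** The maps h1 and h2 embed P1 and P2 in the wreath product, the second one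
    conjugated by the shift along B. *)
Lemma twisted_amalgam (p : nat) (gT : finGroupType) (B P1 P2 : {group gT}) :
    prime p -> p.-group (P1 <*> P2) ->
  exists (rT : finGroupType) (h1 h2 : gT -> rT),
  [/\ {morph h1 : x y / x * y}, {morph h2 : x y / x * y},
      injective h1, injective h2 & {in B, h1 =1 h2}] /\
  let R := P1 <*> P2 in let R' := <<h1 @: P1 :|: h2 @: P2>> in
  [/\ p.-group R',
      forall e, (forall x, x \in R -> x ^+ e = 1) ->
        forall x, x \in R' -> x ^+ (p * e) = 1 &
      #|R| * p ^ #|R : B| <= #|R'| * p ^ (#|R : P1| + #|R : P2|)].
Proof.
move=> p_pr pR; set R := P1 <*> P2.
pose L (H : {group gT}) := (@lin_morphism gT p @* H)%G.
pose M := @shifts gT p.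
pose m := shift (bump_coset p B).
have injl : 'injm (@lin_morphism gT p) by apply/injmP; apply: in2W (@lin_inj gT p).
have abelM : p.-abelem M := shifts_abelem gT p_pr.
have LR : L P1 <*> L P2 = L (P1 <*> P2)%G by rewrite -morphimY ?subsetT.
have nML H : L H \subset 'N(M).
  by apply/subsetP=> _ /morphimP[x _ _ ->]; apply: lin_norm_shifts.
have nMR : L P1 <*> L P2 \subset 'N(M) by rewrite LR.
have tiRM : (L P1 <*> L P2) :&: M = 1.
  rewrite LR; apply/trivgP/subsetP=> _ /setIP[/morphimP[x _ _ ->] /imsetP[w _ /= eqw]].
  by rewrite inE (lin_shift_trivI eqw) -[1 in X in _ == X](morph1 (@lin_morphism gT p)).
have mM : m \in M := mem_shift _.
exists _, (@lin gT p), (fun x => lin p x ^ m).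
have defR' : <<lin p @: P1 :|: (fun x => lin p x ^ m) @: P2>> = L P1 <*> (L P2) :^ m.
  rewrite /joing; congr <<_ :|: _>>; first by rewrite /L /= morphimEsub ?subsetT.
  rewrite /L /= morphimEsub ?subsetT //.
  apply/setP=> y; apply/imsetP/imsetP=> [[x xP ->]|[_ /imsetP[x xP ->] ->]];
    last by exists x.
  by exists (lin p x); rewrite // imset_f.
split.
  split.
  - exact: linM.
  - by move=> x y; rewrite linM conjMg.
  - exact: lin_inj.
  - by move=> x y /conjg_inj /lin_inj.
  - by move=> x xB; rewrite (bump_coset_cent p xB).
have sR' := twist_mul_sub nMR mM.
move=> R1 R'; rewrite /R' defR'.
split.
- have sR'J : L P1 <*> (L P2) :^ m \subset (L P1 <*> L P2) <*> M.
    by rewrite (norm_joinEl nMR); apply: sR'.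
  apply: pgroupS sR'J _.
  have pLR : p.-group (L P1 <*> L P2) by rewrite LR morphim_pgroup.
  by rewrite /= (norm_joinEl nMR) pgroupM (abelem_pgroup abelM) andbT.
- move=> e Re x xR'.
  have [r y rR yM ->] := mulsgP (subsetP sR' x xR').
  rewrite mulnC expgnA.
  have nr : r \in 'N(M) := subsetP nMR r rR.
  have ny : y \in 'N(M) := subsetP (normG M) y yM.
  have: (r * y) ^+ e \in M.
    apply: coset_idr; rewrite ?groupX ?groupM // morphX ?groupM // morphM //=.
    rewrite (coset_id yM) mulg1 -morphX //.
    have : r \in L (P1 <*> P2)%G by rewrite -LR.
    case/morphimP=> x' _ x'R ->.
    by rewrite -morphX ?inE // Re // !morph1.
  by have [_ expM] := abelemP p_pr abelM; apply: expM.
have cardL (H : {group gT}) : #|L H| = #|H| by rewrite card_injm ?subsetT.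
have indL (H K : {group gT}) : H \subset K -> #|L K : L H| = #|K : H|.
  by move=> sHK; rewrite index_injm ?subsetT.
have -> := twist_card nMR tiRM mM.
have cardLR : #|L P1 <*> L P2| = #|R1| by rewrite LR cardL.
rewrite cardLR -mulnA leq_pmul2l ?cardG_gt0 //.
apply: leq_trans (card_bump_coset p_pr B (P1 <*> P2)) _.
have indLR (P : {group gT}) : P \subset R1 -> #|L P1 <*> L P2 : L P| = #|R1 : P|.
  by move=> sPR; rewrite LR indL.
have := card_conj_twist p_pr abelM nMR mM.
rewrite !indLR ?joing_subl ?joing_subr //.
apply: leq_trans; apply/eq_leq/(congr1 (fun X : {set _} => #|<<X>>|))/setP=> y.
have defL : L P1 <*> L P2 = lin p @: (P1 <*> P2).
  by rewrite LR /L /= morphimEsub ?subsetT.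
apply/imsetP/imsetP=> [[x xR ->]|[z]].
  by exists (lin p x); rewrite //= defL imset_f.
by rewrite /= defL => /imsetP[x xR ->] ->; exists x.
Qed.
End TwistedAmalgam.

From mathcomp Require Import boolp classical_sets functions cardinality.
From mathcomp Require Import filter topology.

(** * Totally disconnected compact spaces *)

Section ZeroDimensional.
Local Open Scope classical_set_scope.

(** Otherwise the sets B :&: closure S generate a filter on B, which has a cluster point
    in B. *)
Lemma compact_avoid_closure (T : topologicalType) (B : set T) (F : set_system T) :
    compact B -> Filter F ->
    (forall b, B b -> exists2 S, F S & ~ closure S b) ->
  exists2 S, F S & forall b, B b -> ~ closure S b.
Proof.
move=> cB FF FB; apply: contrapT => noS.
pose H := filter_from F (fun S => B `&` closure S).
have FH : ProperFilter H.
  apply: filter_from_proper; last first.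
    move=> S FS; apply: contrapT => BS; apply: noS; exists S => // b Bb Sb.
    by apply: BS; exists b.
  apply: filter_from_filter; first by exists setT; apply: filterT.
  move=> S S' FS FS'; exists (S `&` S'); first exact: filterI.
  move=> b [Bb /closureI[Sb S'b]]; split; split=> //.
have HB : H B by exists setT; [exact: filterT | move=> b []].
have [b [Bb clb]] := cB H FH HB.
have [S FS nSb] := FB b Bb.
have nb : nbhs b (~` closure S).
  by apply: open_nbhs_nbhs; split=> //; apply/closed_openC/closed_closure.
have [|c [[_ Sc] nSc]] := clb (B `&` closure S) (~` closure S) _ nb; last exact: nSc.
by exists S.
Qed.

Lemma open_disjoint_closure (T : topologicalType) (P Q : set T) z :
  open P -> P z -> P `&` Q = set0 -> ~ closure Q z.
Proof.
move=> oP Pz PQ clz; have [w [Qw Pw]] := clz P (open_nbhs_nbhs (conj oP Pz)).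
by have : (P `&` Q) w by []; rewrite PQ.
Qed.

Lemma compact_separate (T : topologicalType) (A B : set T) :
    hausdorff_space T -> compact A -> compact B -> A `&` B = set0 ->
  exists U, [/\ open U, A `<=` U & forall b, B b -> ~ closure U b].
Proof.
move=> hT cA cB AB0.
pose F := filter_from [set S : set T | open S /\ A `<=` S] id.
have FF : Filter F.
  apply: filter_from_filter; first by exists setT; split => //; apply: openT.
  move=> S S' [oS AS] [oS' AS']; exists (S `&` S') => //.
  by split; [apply: openI | move=> a Aa; split; [apply: AS | apply: AS']].
have [|U [S [oS AS] SU] UB] := @compact_avoid_closure T B F cB FF.
  move=> b Bb.
  have [|W Wb WA] := @compact_avoid_closure T A (nbhs b) cA _.
    move=> a Aa.
    have neq : b != a.
      apply/eqP => eqba; have : (A `&` B) a by split=> //; rewrite -eqba.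
      by rewrite AB0.
    move: hT; rewrite open_hausdorff => /(_ b a neq)[[P Q]] /= [/set_mem Pb /set_mem Qa].
    move=> [oP oQ /eqP PQ0]; exists P; first exact: open_nbhs_nbhs.
    by apply: (open_disjoint_closure oQ Qa); rewrite setIC.
  exists (~` closure W).
    exists (~` closure W) => //; split; last by move=> a /WA.
    exact/closed_openC/closed_closure.
  move: Wb; rewrite nbhsE => -[W' [oW' W'b] W'W].
  apply: (open_disjoint_closure oW' W'b).
  rewrite -subset0 => z [W'z nWz]; apply: nWz; apply: subset_closure.
  exact: W'W.
exists S; split=> // b Bb clb; apply: (UB b Bb).
exact: closureS SU _ clb.
Qed.

(** The intersection Q of all clopen sets around x is connected. If Q were the union
    of separated sets E b, containing x, and E (~~ b), take an open neighbourhood U of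
    E b whose closure misses E (~~ b). By compactness some clopen C around x lies
    in the union of U and the complement of closure U; then C :&: U is clopen
    around x and misses E (~~ b). *)
Lemma totally_disconnected_zero_dimensional (T : topologicalType) :
    compact [set: T] -> hausdorff_space T -> totally_disconnected [set: T] ->
  zero_dimensional T.
Proof.
move=> cT hT tdT x y neq_xy; apply: contrapT => noU.
pose Q := [set z | forall C : set T, clopen C -> C x -> C z].
have Qx : Q x by [].
have Qy : Q y.
  by move=> C clC Cx; apply: contrapT => nCy; apply: noU; exists C.
have closedQ : closed Q.
  move=> z clz C clC Cx; apply: clC.2; apply: closureS clz => w Qw; exact: Qw.
suff connQ : connected Q.
  have : connected_component [set: T] x y by exists Q.
  rewrite tdT // => eqyx; move: neq_xy; rewrite eqyx.
  by rewrite eqxx.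
apply: contrapT => /connectedPn[E [E0 QE [sep1 sep2]]].
have [b Eb] : exists b, E b x.
  by move: Qx; rewrite QE => -[]; [exists false | exists true].
have sep c : closure (E c) `&` E (~~ c) = set0 by case: c; rewrite // setIC.
have QEb z : Q z <-> E b z \/ E (~~ b) z.
  by rewrite QE; case: (b); split=> -[]; [right|left|right|left| left|right|left|right].
have closedE c : closed (E c).
  move=> z clz.
  have : Q z.
    apply: closedQ; apply: closureS clz => w Ecw; apply/QEb.
    by move: Ecw; case: (b); case: c; auto.
  rewrite QE => Qz; apply: contrapT => nEz.
  have : (closure (E c) `&` E (~~ c)) z.
    by split=> //; move: Qz nEz; case: (c) => -[].
  by rewrite sep.
have compE c : compact (E c).
  exact: subclosed_compact (closedE c) cT (subsetT _).
have disjE : E b `&` E (~~ b) = set0.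
  by have := sep b; rewrite -(closure_id _).1.
have [U [oU EU nEU]] := compact_separate hT (compE b) (compE (~~ b)) disjE.
pose F := filter_from [set C : set T | clopen C /\ C x] id.
have FF : Filter F.
  apply: filter_from_filter; first by exists setT; split => //; apply: clopenT.
  by move=> S S' [oS Sx] [oS' Sx']; exists (S `&` S') => //; split; [apply: clopenI|].
have oV : open (~` closure U) by exact/closed_openC/closed_closure.
have cK : compact (~` (U `|` ~` closure U)).
  by apply: subclosed_compact cT (subsetT _); apply/open_closedC/openU.
have [|S [C [[oC cC] Cx] CS] nS] := compact_avoid_closure cK FF.
  move=> z nz; have nQz : ~ Q z.
    by move/QEb => -[/EU Uz|/nEU nUz]; apply: nz; [left|right].
  have [C [clC Cx] nCz] : exists2 C : set T, clopen C /\ C x & ~ C z.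
    apply: contrapT => noC; apply: nQz => C clC Cx.
    by apply: contrapT => nCz; apply: noC; exists C.
  exists C; first by exists C.
  by rewrite -(closure_id _).1 //; case: clC.
have CUV z : C z -> U z \/ ~ closure U z.
  move=> Cz; apply: contrapT => nz.
  by apply: (nS z nz); apply: subset_closure; apply: CS.
have clopenCU : clopen (C `&` U).
  split; first exact: openI.
  move=> z /closureI[clC clU]; have Cz : C z by apply: cC.
  by split=> //; case: (CUV z Cz).
have [z Ez] := E0 (~~ b).
have [_ Uz] : (C `&` U) z.
  by have : Q z by [apply/QEb; right]; apply => //; split=> //; apply: EU.
exact: nEU z Ez (subset_closure Uz).
Qed.
End ZeroDimensional.

(** * Open normal subgroups *)

Section OpenNormal.
Local Open Scope classical_set_scope.
Local Open Scope group_scope.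

Lemma normal_subgroupP (G : topologicalGroupType) (N : set G) :
  normal_subgroup N <->
  [/\ N 1, forall x y, N x -> N y -> N (x * y^-1) & forall x y, N x -> N (x ^ y)].
Proof.
split=> [[[N1 NF] NJ] | [N1 NF NJ]].
  split=> // [|x y /mem_set Nx /mem_set Ny]; first exact/set_mem.
  by apply/set_mem; apply: NF.
split=> //; split; first exact: mem_set.
by move=> x y /set_mem Nx /set_mem Ny; apply: mem_set; apply: NF.
Qed.

Lemma mulg_cvg (G : topologicalGroupType) (T : Type) (F : set_system T)
    (f g : T -> G) x y :
  Filter F -> f t @[t --> F] --> x -> g t @[t --> F] --> y ->
  f t * g t @[t --> F] --> x * y.
Proof.
move=> FF fx gy; apply: (cvg_comp2 (h := fun a b : G => a * b) fx gy).
exact: (@mulg_continuous G (x, y)).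
Qed.

(** The two-sided stabilizer N of U is a normal subgroup, since its condition is
    invariant under replacing x and y. It is open because U is clopen and the pairs
    (x, y) range over a compact set. *)
Lemma open_normal_in_clopen (G : topologicalGroupType) (U : set G) :
  compact [set: G] -> clopen U -> U 1 ->
  exists N : set G, [/\ open N, normal_subgroup N & N `<=` U].
Proof.
move=> cG [oU cU] U1.
pose N := [set v : G | forall x y, U (x * v * y) <-> U (x * y)].
exists N; split; last by move=> v /(_ 1 1); rewrite !mulg1 !mul1g => ->.
  rewrite openE => v Nv.
  have cGG : compact [set: G * G] by rewrite -setXTT; apply: compact_setX.
  pose P v' (xy : G * G) := U (xy.1 * v' * xy.2) <-> U (xy.1 * xy.2).
  have := (iffLR (compact_near_coveringP _) cGG _ (nbhs v) P _).
  have near_xy (xy : G * G) : \forall x' \near xy & i \near v, P i x'.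
    have cx : t.1.1 @[t --> (xy, v)] --> xy.1.
      exact: cvg_comp cvg_fst cvg_fst.
    have cy : t.1.2 @[t --> (xy, v)] --> xy.2.
      exact: cvg_comp cvg_fst cvg_snd.
    have c1 : t.1.1 * t.1.2 @[t --> (xy, v)] --> xy.1 * xy.2 by apply: mulg_cvg.
    have c2 : t.1.1 * t.2 * t.1.2 @[t --> (xy, v)] --> xy.1 * v * xy.2.
      by apply: mulg_cvg => //; apply: mulg_cvg => //; apply: cvg_snd.
    have near_eq (V : set G) : open V -> V (xy.1 * xy.2) -> V (xy.1 * v * xy.2) ->
        \forall x' \near xy & i \near v, V (x'.1 * x'.2) /\ V (x'.1 * i * x'.2).
      move=> oV V1 V2.
      have n1 : \forall t \near (xy, v), V (t.1.1 * t.1.2).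
        exact: c1 _ (open_nbhs_nbhs (conj oV V1)).
      have n2 : \forall t \near (xy, v), V (t.1.1 * t.2 * t.1.2).
        exact: c2 _ (open_nbhs_nbhs (conj oV V2)).
      exact: filterS2 n1 n2.
    have [Uxy|nUxy] := pselect (U (xy.1 * xy.2)).
      have := near_eq U oU Uxy (iffRL (Nv _ _) Uxy).
      by apply: filterS => -[[x y] i] /= [].
    have := near_eq _ (closed_openC cU) nUxy (fun h => nUxy (iffLR (Nv _ _) h)).
    by apply: filterS => -[[x y] i] /= [].
  move=> /(_ _ (fun xy _ => near_xy xy)) NN.
  apply: filterS NN => w Nw x y; exact: (Nw (x, y)).
apply/normal_subgroupP; split.
- by move=> x y; rewrite mulg1.
- move=> v w Nv Nw x y.
  have -> : x * (v * w^-1) * y = x * v * (w^-1 * y) by rewrite !mulgA.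
  by rewrite (Nv x (w^-1 * y)) mulgA -(Nw (x * w^-1) y) mulgVK.
- move=> v z Nv x y.
  have -> : x * v ^ z * y = (x * z^-1) * v * (z * y) by rewrite conjgE !mulgA.
  by rewrite (Nv (x * z^-1) (z * y)) mulgA mulgVK.
Qed.
End OpenNormal.

(** * Finite quotients of pro-p groups *)

Section FiniteQuotients.
Local Open Scope group_scope.
Local Open Scope classical_set_scope.

Lemma left_coset_eqP (G : topologicalGroupType) (N : set G) x y :
    N 1 -> (forall a b, N a -> N b -> N (a * b^-1)) ->
  [set x * h | h in N] = [set y * h | h in N] <-> N (x^-1 * y).
Proof.
move=> N1 NF; have NV a : N a -> N a^-1 by move=> /(NF _ _ N1); rewrite mul1g.
have NM a b : N a -> N b -> N (a * b) by move=> Na /NV /(NF _ _ Na); rewrite invgK.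
split=> [eqxy|Nxy].
  have : [set x * h | h in N] y by rewrite eqxy; exists 1; rewrite ?mulg1.
  by case=> h Nh <-; rewrite mulKg.
apply/seteqP; split=> _ [h Nh <-].
  exists ((x^-1 * y)^-1 * h); first exact: NM (NV _ Nxy) Nh.
  by rewrite invMg invgK !mulgA mulgV mul1g.
by exists (x^-1 * y * h); [apply: NM|rewrite !mulgA mulgV mul1g].
Qed.

(** Indices are handled through a function that labels the left cosets. *)
Lemma has_indexP (G : topologicalGroupType) (N : set G) n :
    N 1 -> (forall a b, N a -> N b -> N (a * b^-1)) ->
  has_index N n <-> exists idx : G -> 'I_n,
    (forall i, exists g, idx g = i) /\
    (forall x y, idx x = idx y <-> N (x^-1 * y)).
Proof.
move=> N1 NF; have NV a : N a -> N a^-1 by move=> /(NF _ _ N1); rewrite mul1g.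
split=> [/card_set_bijP[f [fF fI fS]] | [idx [idxS idxE]]].
  have lt_f x : (f [set (x * h)%g | h in N] < n)%N by apply: fF; exists x.
  exists (fun x => Ordinal (lt_f x)); split.
    move=> i; have [_ [g _ <-] fgi] := fS i (ltn_ord i).
    by exists g; apply: val_inj.
  move=> x y; rewrite -(left_coset_eqP x y N1 NF); split=> [/(congr1 val)/= eqf|eqN].
    by apply: fI => //; apply: mem_set; eexists.
  by apply: val_inj; rewrite /= eqN.
apply/card_set_bijP; exists (fun C : set G => idx (xget 1 C) : nat).
have idxC x : idx (xget 1 [set x * h | h in N]) = idx x.
  case: xgetP => [_ -> [h Nh <-]|/(_ x)[]]; last by exists 1; rewrite ?mulg1.
  by apply/esym/idxE; rewrite mulKg.
split.
- by move=> _ [x _ <-] /=; apply: ltn_ord.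
- move=> _ _ /set_mem[x _ <-] /set_mem[y _ <-]; rewrite !idxC => /val_inj /idxE.
  by move/(left_coset_eqP x y N1 NF).
- move=> k /= lt_k; have [g idxg] := idxS (Ordinal lt_k).
  by exists [set g * h | h in N]; [exists g | rewrite idxC idxg].
Qed.

Definition image_set (G : Type) (gT : finGroupType) (f : G -> gT) : {set gT} :=
  [set y | `[< exists x, f x = y >]]%SET.

Lemma image_setP (G : Type) (gT : finGroupType) (f : G -> gT) y :
  reflect (exists x, f x = y) (y \in image_set f).
Proof. by rewrite inE; apply: asboolP. Qed.

Lemma mem_image_set (G : Type) (gT : finGroupType) (f : G -> gT) x :
  f x \in image_set f.
Proof. by apply/image_setP; exists x. Qed.

Lemma image_group_set (G : groupType) (gT : finGroupType) (f : G -> gT) :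
  {morph f : x y / x * y} -> group_set (image_set f).
Proof.
move=> fM; apply/group_setP; split.
  apply/image_setP; exists 1; apply: (mulgI (f 1)).
  by rewrite -fM !mulg1.
by move=> _ _ /image_setP[x <-] /image_setP[y <-]; rewrite -fM mem_image_set.
Qed.

(** The quotient is realized by the permutations of the labels of the left cosets.
    Inverses appear because products of permutations are read from left to
    right. The image has as many elements as N has cosets. *)
Lemma finite_quotient (p : nat) (G : topologicalGroupType) (N : set G) :
    prime p -> pro_p p G -> open N -> normal_subgroup N ->
  exists (gT : finGroupType) (f : G -> gT),
    [/\ {morph f : x y / x * y}, forall x y, f x = f y <-> N (x^-1 * y) &
        p.-group (image_set f)].
Proof.
move=> p_pr [_ ppG] oN nN; have [k indN] := ppG N oN nN.
have /normal_subgroupP[N1 NF NJ] := nN.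
have [idx [idxS idxE]] := iffLR (has_indexP _ N1 NF) indN.
have [r rK] : exists r : 'I_(p ^ k) -> G, forall i, idx (r i) = i.
  by exists (fun i => projT1 (cid (idxS i))) => i; case: cid.
pose a g (i : 'I_(p ^ k)) := idx (g^-1 * r i).
have aE g h : idx (g^-1 * r (idx h)) = idx (g^-1 * h).
  apply/idxE; rewrite invMg invgK -mulgA mulKVg.
  by apply/idxE; rewrite rK.
have aI g : injective (a g).
  move=> i j /idxE; rewrite invMg invgK -mulgA mulKVg => /idxE.
  by rewrite !rK.
pose f g : {perm 'I_(p ^ k)} := perm (@aI g).
have fE x y : f x = f y <-> N (x^-1 * y).
  split=> [eqf|Nxy].
    have := congr1 (fun s : {perm _} => s (idx x)) eqf; rewrite !permE /a !aE.
    move/idxE; rewrite mulVg invg1 mul1g => NyVx.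
    by have := NF _ _ N1 NyVx; rewrite mul1g invMg invgK.
  apply/permP=> i; rewrite !permE; apply/idxE.
  have : N (y * x^-1) by have := NJ _ x^-1 Nxy; rewrite conjgE invgK -mulgA mulKVg.
  move=> /(NF _ _ N1) /(NJ _ (r i)).
  by rewrite mul1g conjgE !invMg !invgK !mulgA.
have fM : {morph f : x y / x * y}.
  by move=> x y; apply/permP=> i; rewrite permM !permE /a aE invMg mulgA.
exists {perm 'I_(p ^ k)}, f; split=> //.
have -> : image_set f = [set f (r i) | i in [set: 'I_(p ^ k)]]%SET.
  apply/setP=> s; apply/image_setP/imsetP=> [[x <-]|[i _ ->]]; last by exists (r i).
  exists (idx x); rewrite ?inE //; apply/fE/idxE; by rewrite rK.
rewrite /pgroup card_imset; last by move=> i j /fE/idxE; rewrite !rK.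
by rewrite cardsT card_ord pnatX pnat_id.
Qed.
End FiniteQuotients.

(** * Finite groups as discrete topological groups *)

Definition discrete_group (gT : finGroupType) : Type := gT.
HB.instance Definition _ (gT : finGroupType) :=
  Group.copy (discrete_group gT) gT.
HB.instance Definition _ (gT : finGroupType) :=
  hasNbhs.Build (discrete_group gT) (@principal_filter gT).
HB.instance Definition _ (gT : finGroupType) :=
  Discrete_ofNbhs.Build (discrete_group gT) erefl.

Lemma discrete_mulg_continuous (gT : finGroupType) :
  continuous (fun xy : discrete_group gT * discrete_group gT => (xy.1 * xy.2)%g).
Proof.
move=> [x y] A; rewrite /= => Axy.
exists ([set x], [set y])%classic; first by split; apply/principal_filterP.
by move=> [a b] /= [-> ->]; apply: nbhs_singleton Axy.
Qed.

Lemma discrete_invg_continuous (gT : finGroupType) :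
  continuous (fun x : discrete_group gT => (x^-1)%g).
Proof.
move=> x A Ax; apply/principal_filterP; exact: nbhs_singleton Ax.
Qed.

HB.instance Definition _ (gT : finGroupType) :=
  isTopologicalGroup.Build (discrete_group gT)
    (@discrete_mulg_continuous gT) (@discrete_invg_continuous gT).

Section DiscreteGroups.
Local Open Scope group_scope.
Local Open Scope classical_set_scope.

Lemma discrete_pro_p (p : nat) (gT : finGroupType) :
  p.-group [set: gT]%SET -> pro_p p (discrete_group gT).
Proof.
move=> pgT; split.
  split; first by apply: finite_compact; apply: (@finite_finset gT).
    exact: discrete_hausdorff.
  exact/zero_dimension_totally_disconnected/discrete_zero_dimension.
move=> N _ /normal_subgroupP[N1 NF _].
have NV a : N a -> N a^-1 by move=> /(NF _ _ N1); rewrite mul1g.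
pose H0 : {set gT} := [set x : gT | `[< N x >]]%SET.
have inH x : reflect (N x) (x \in H0) by rewrite inE; apply: asboolP.
have gH : group_set H0.
  apply/group_setP; split; first exact/inH.
  move=> x y /inH Nx /inH Ny; apply/inH; rewrite -(invgK y).
  by apply: NF => //; apply: NV.
pose H := Group gH.
have [k indH] := p_natP (pnat_dvd (dvdn_indexg [set: gT]%G H) pgT).
exists k; rewrite -indH -card_lcosets.
have HH : gval H \in lcosets H [set: gT]%SET by apply/lcosetsP; exists 1; rewrite ?mul1g.
apply/(has_indexP _ N1 NF).
have inL (x : gT) : x *: H \in lcosets H [set: gT]%SET by apply/lcosetsP; exists x.
exists (fun x : gT => enum_rank_in HH (x *: H)); split.
  move=> i; have /lcosetsP[x _ defi] := enum_valP i.
  by exists x; rewrite -defi enum_valK_in.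
move=> x y; split=> [/enum_rank_in_inj-/(_ (inL x) (inL y)) eqxy|Nxy].
  by apply/inH; rewrite -mem_lcoset -[_ *: _]/(x *: H) eqxy lcoset_refl.
congr (enum_rank_in _ _); apply/lcoset_eqP; rewrite mem_lcoset.
by apply/inH; have := NV _ Nxy; rewrite invMg invgK.
Qed.

(** Continuity of f for the discrete topology on X, stated without a topology on X. *)
Definition locally_constant (T : topologicalType) (X : Type) (f : T -> X) :=
  forall y, open (f @^-1` [set y]).

Lemma locally_constant_open (T : topologicalType) (X : Type) (f : T -> X) (A : set X) :
  locally_constant f -> open (f @^-1` A).
Proof.
move=> lf; have -> : f @^-1` A = \bigcup_(y in A) (f @^-1` [set y]).
by apply/seteqP; split=> [x Afx|x [y Ay fxy]]; [exists (f x) | rewrite /preimage /= fxy].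
by apply: bigcup_open => y _; apply: lf.
Qed.

Lemma locally_constant_closed (T : topologicalType) (X : Type) (f : T -> X) (A : set X) :
  locally_constant f -> closed (f @^-1` A).
Proof.
move=> /(@locally_constant_open T X f (~` A)); rewrite preimage_setC.
by move=> /open_closedC; rewrite setCK.
Qed.

Lemma locally_constant_comp (T U : topologicalType) (X : Type) (f : T -> X) (g : U -> T) :
  locally_constant f -> continuous g -> locally_constant (f \o g).
Proof.
by move=> lf cg y; rewrite comp_preimage; apply: open_comp => // x _; apply: cg.
Qed.

Lemma locally_constant_continuous (T : topologicalType) (gT : finGroupType)
    (f : T -> discrete_group gT) : locally_constant f -> continuous f.
Proof.
move=> lf x A Ax; rewrite /nbhs /=.
apply: open_nbhs_nbhs; split; first exact: locally_constant_open.
exact: nbhs_singleton Ax.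
Qed.

Lemma continuous_locally_constant (T : topologicalType) (gT : finGroupType)
    (f : T -> discrete_group gT) : continuous f -> locally_constant f.
Proof. by move=> cf y; apply: open_comp => [x _|]; [apply: cf|apply: discrete_open]. Qed.

End DiscreteGroups.

(** * Finite images of a pushout *)

Section FiniteImages.
Local Open Scope group_scope.
Local Open Scope classical_set_scope.

(** A continuous homomorphism to the discrete group gT. *)
Definition finite_hom (G : topologicalGroupType) (gT : finGroupType) (f : G -> gT) :=
  {morph f : x y / x * y} /\ locally_constant f.

Lemma morph_1 (G H : groupType) (f : G -> H) : {morph f : x y / x * y} -> f 1 = 1.
Proof. by move=> fM; apply: (mulgI (f 1)); rewrite -fM !mulg1. Qed.

Lemma morph_V (G H : groupType) (f : G -> H) x :
  {morph f : x y / x * y} -> f x^-1 = (f x)^-1.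
Proof. by move=> fM; apply: (mulgI (f x)); rewrite -fM !mulgV morph_1. Qed.

Lemma morph_X (G H : groupType) (f : G -> H) x n :
  {morph f : x y / x * y} -> f (x ^+ n) = f x ^+ n.
Proof. by move=> fM; elim: n => [|n IHn]; rewrite ?morph_1 // !expgS fM IHn. Qed.

Lemma continuous_hom_comp (G H K : topologicalGroupType) (i : G -> H) (j : H -> K) :
  continuous_hom i -> continuous_hom j -> continuous_hom (j \o i).
Proof.
move=> [[i_1 iM] ci] [[j_1 jM] cj]; split; last first.
  by move=> a; apply: continuous_comp; [apply: ci | apply: cj].
by split=> [|x y] /=; rewrite ?i_1 // iM jM.
Qed.

Lemma finite_hom_comp (G H : topologicalGroupType) (gT : finGroupType)
    (f : H -> gT) (j : G -> H) :
  finite_hom f -> continuous_hom j -> finite_hom (f \o j).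
Proof.
move=> [fM lf] [[_ jM] cj]; split; last exact: locally_constant_comp.
by move=> x y /=; rewrite jM fM.
Qed.

Lemma finite_hom_into (G : topologicalGroupType) (gT : finGroupType)
    (R : {group gT}) (f : G -> gT) :
  finite_hom f -> image_set f \subset R ->
  continuous_hom (fun x => subg R (f x) : discrete_group (subg_of R)).
Proof.
move=> [fM lf] sfR; have fR x : f x \in R by rewrite (fintype.subsetP sfR) ?mem_image_set.
split; first split.
- by rewrite morph_1 // morph1.
- by move=> x y; rewrite fM; apply: subgM; apply: fR.
apply: locally_constant_continuous => y.
suff -> : (fun x => subg R (f x)) @^-1` [set y] = f @^-1` [set sgval y] by apply: lf.
apply/seteqP; split=> x /=; first by move <-; rewrite subgK.
by move=> ->; apply: sgvalK.
Qed.

Lemma finite_hom_outof (G : topologicalGroupType) (gT : finGroupType) (R : {group gT})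
    (f : G -> discrete_group (subg_of R)) :
  continuous_hom f -> finite_hom (fun x => sgval (f x)).
Proof.
move=> [[f1 fM] cf]; split.
  by move=> x y; rewrite fM; apply: sgvalM; apply: finset.in_setT.
move=> y; apply: (@locally_constant_open _ _ f [set z | sgval z = y]).
exact: continuous_locally_constant.
Qed.

Lemma subg_pro_p (p : nat) (gT : finGroupType) (R : {group gT}) :
  p.-group R -> pro_p p (discrete_group (subg_of R)).
Proof.
move=> pR; apply: discrete_pro_p.
by rewrite -(injm_pgroup (injm_sgval R)) ?subxx // im_sgval.
Qed.

(** The universal property is applied to the discrete p-group generated by both images.
    Since the target is that group itself, f is onto it. *)
Lemma pushout_finite (p : nat) (A G1 G2 G : topologicalGroupType)
    (i1 : A -> G1) (i2 : A -> G2) (j1 : G1 -> G) (j2 : G2 -> G)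
    (gT : finGroupType) (f1 : G1 -> gT) (f2 : G2 -> gT) :
  pro_p_pushout p i1 i2 j1 j2 -> finite_hom f1 -> finite_hom f2 ->
  f1 \o i1 = f2 \o i2 -> p.-group <<image_set f1 :|: image_set f2>> ->
  exists f : G -> gT, [/\ finite_hom f, f \o j1 = f1, f \o j2 = f2 &
                        image_set f = <<image_set f1 :|: image_set f2>>%SET].
Proof.
move=> [_ _ _ _ univ] hf1 hf2 eqi pR; set R0 := <<_>> in pR *.
pose R := [group of R0].
have sR : image_set f1 :|: image_set f2 \subset R by apply: subset_gen.
have [sR1 sR2] : image_set f1 \subset R /\ image_set f2 \subset R.
  by apply/andP; rewrite -finset.subUset.
have [|f [[hf fj1 fj2] _]] := univ _ _ _ (subg_pro_p pR)
  (finite_hom_into hf1 sR1) (finite_hom_into hf2 sR2).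
  by apply/funext=> a /=; rewrite -[f1 _]/((f1 \o i1) a) eqi.
pose F x := sgval (f x).
have Fj1 : F \o j1 = f1.
  apply/funext=> x; rewrite /F /= -[f _]/((f \o j1) x) fj1 subgK //.
  by rewrite (fintype.subsetP sR1) ?mem_image_set.
have Fj2 : F \o j2 = f2.
  apply/funext=> x; rewrite /F /= -[f _]/((f \o j2) x) fj2 subgK //.
  by rewrite (fintype.subsetP sR2) ?mem_image_set.
have hF : finite_hom F := finite_hom_outof hf.
exists F; split => //.
apply/eqP; rewrite finset.eqEsubset; apply/andP; split.
  by apply/fintype.subsetP=> _ /image_setP[x <-]; apply: subgP.
pose PF := Group (image_group_set hF.1).
have <- : gval PF = image_set F by [].
rewrite gen_subG finset.subUset.
apply/andP; split; apply/fintype.subsetP=> _ /image_setP[x <-].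
  by rewrite -Fj1; apply: mem_image_set.
by rewrite -Fj2; apply: mem_image_set.
Qed.

(** Both f and the map provided by [pushout_finite] factor f through its image, so they
    agree by uniqueness. *)
Lemma pushout_image (p : nat) (A G1 G2 G : topologicalGroupType)
    (i1 : A -> G1) (i2 : A -> G2) (j1 : G1 -> G) (j2 : G2 -> G)
    (gT : finGroupType) (f : G -> gT) :
  pro_p_pushout p i1 i2 j1 j2 -> finite_hom f -> p.-group (image_set f) ->
  image_set f = <<image_set (f \o j1) :|: image_set (f \o j2)>>%SET.
Proof.
move=> po hf pf; have [_ cj1 cj2 eqj univ] := po.
pose P := Group (image_group_set hf.1).
have hf1 := finite_hom_comp hf cj1; have hf2 := finite_hom_comp hf cj2.
have sub1 : image_set (f \o j1) \subset P.
  by apply/fintype.subsetP=> _ /image_setP[x <-]; apply: mem_image_set.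
have sub2 : image_set (f \o j2) \subset P.
  by apply/fintype.subsetP=> _ /image_setP[x <-]; apply: mem_image_set.
have sRP : <<image_set (f \o j1) :|: image_set (f \o j2)>> \subset P.
  by rewrite gen_subG finset.subUset sub1.
have eqi : (f \o j1) \o i1 = (f \o j2) \o i2.
  by apply/funext=> a /=; rewrite -[j1 _]/((j1 \o i1) a) eqj.
have pR := pgroupS sRP pf.
have [F [hF Fj1 Fj2 imF]] := pushout_finite po hf1 hf2 eqi pR.
have sFP : image_set F \subset P by rewrite imF.
rewrite -imF; suff -> : F = f by [].
have eqi' : (fun x => subg P ((f \o j1) x)) \o i1 = (fun x => subg P ((f \o j2) x)) \o i2.
  by apply/funext=> a /=; rewrite -[j1 _]/((j1 \o i1) a) eqj.
have [g [_ uniq]] := univ _ _ _ (subg_pro_p (R := P) pf)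
  (finite_hom_into hf1 sub1) (finite_hom_into hf2 sub2) eqi'.
have gF : g = (fun x => subg P (F x)).
  apply: uniq; split; first exact: finite_hom_into.
    by rewrite -Fj1.
  by rewrite -Fj2.
have gf : g = (fun x => subg P (f x)).
  by apply: uniq; split => //; exact: (finite_hom_into (R := P) hf (subxx _)).
apply/funext=> x.
have := congr1 (fun h : G -> _ => sgval (h x)) gF; rewrite gf /=.
rewrite !subgK //; first by rewrite (fintype.subsetP sFP) ?mem_image_set.
exact: mem_image_set.
Qed.
End FiniteImages.

(** * Bounded generation and finite images *)

Section Generation.
Local Open Scope group_scope.
Local Open Scope classical_set_scope.

Lemma finite_hom_closed_cycle (G : topologicalGroupType) (gT : finGroupType)
    (f : G -> gT) g x :
  finite_hom f -> closed_cycle g x -> f x \in cycle (f g).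
Proof.
move=> [fM lf]; have cl : closed (f @^-1` [set y | y \in cycle (f g)]).
  exact: locally_constant_closed.
move=> gx; apply: cl; apply: closureS gx => _ [n [->|->]] /=.
  by rewrite morph_X // mem_cycle.
by rewrite morph_V // morph_X // groupV mem_cycle.
Qed.

(** The map f sends the closure of the powers of g to powers of f g, because the
    preimage of a subset of a finite group is closed. *)
Lemma boundedly_generated_image (G : topologicalGroupType) :
  boundedly_generated G -> exists d, forall (gT : finGroupType) (f : G -> gT),
    finite_hom f -> exists2 s, size s = d & prod_cycles s = image_set f.
Proof.
move=> [d [g bG]]; exists (size (index_enum 'I_d)) => gT f hf; have [fM lf] := hf.
exists [seq f (g i) | i <- index_enum 'I_d]; first by rewrite size_map.
apply/eqP; rewrite finset.eqEsubset; apply/andP; split.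
  have -> : image_set f = Group (image_group_set fM) by [].
  by apply: prod_cycles_sub => _ /mapP[i _ ->]; apply: mem_image_set.
apply/fintype.subsetP=> _ /image_setP[x <-]; have [h hg ->] := bG x.
rewrite (big_morph f fM (morph_1 fM)) /prod_cycles big_map.
apply/prodsgP; exists (fun i => f (h i)) => // i _.
exact: finite_hom_closed_cycle.
Qed.

Lemma profinite_open_normal (G : topologicalGroupType) (W : set G) :
  profinite G -> nbhs 1 W -> exists N : set G, [/\ open N, normal_subgroup N & N `<=` W].
Proof.
move=> [cG hG tG] W1.
have zG := totally_disconnected_zero_dimensional cG hG tG.
have [U [U1 clU] UW] := zero_dimensional_cvg (x := 1) hG zG cG W1.
have [N [oN nN NU]] := open_normal_in_clopen cG clU U1.
by exists N; split=> //; apply: subset_trans NU UW.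
Qed.

Lemma finite_quotient_hom (p : nat) (G : topologicalGroupType) (N : set G) :
    prime p -> pro_p p G -> open N -> normal_subgroup N ->
  exists (gT : finGroupType) (f : G -> gT),
    [/\ finite_hom f, forall x y, f x = f y <-> N (x^-1 * y) &
        p.-group (image_set f)].
Proof.
move=> p_pr ppG oN nN; have [gT [f [fM fE pf]]] := finite_quotient p_pr ppG oN nN.
exists gT, f; split=> //; split=> // y.
have [[x <-]|nox] := pselect (exists x, f x = y); last first.
  suff -> : f @^-1` [set y] = set0 by apply: open0.
  by rewrite -subset0 => x fxy; apply: nox; exists x.
have -> : f @^-1` [set f x] = (fun z => x^-1 * z) @^-1` N.
  by apply/seteqP; split=> z /=; [move/esym/fE | move/fE].
apply: open_comp => // z _.
by apply: mulg_cvg; [apply: cvg_cst | apply: cvg_id].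
Qed.

Lemma finite_separation (p : nat) (G : topologicalGroupType) (C : set G) (s : seq G) :
    prime p -> pro_p p G -> closed C -> (forall x, x \in s -> ~ C x) ->
  exists (gT : finGroupType) (f : G -> gT),
    [/\ finite_hom f, p.-group (image_set f) &
        forall x c, x \in s -> C c -> f c <> f x].
Proof.
move=> p_pr ppG clC nCs.
have W1 : nbhs 1 [set z | forall x, x \in s -> ~ C (x * z)].
  elim: s nCs => [|x s IHs] nCs; first by apply: filterS filterT.
  have nCx : nbhs 1 ((fun z => x * z) @^-1` (~` C)).
    have : x * z @[z --> (1 : G)] --> x * 1.
      by apply: mulg_cvg; [apply: cvg_cst | apply: cvg_id].
    apply; rewrite mulg1; apply: open_nbhs_nbhs; split; first exact: closed_openC.
    by apply: nCs; rewrite mem_head.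
  have {}IHs := IHs (fun y ys => nCs y (mem_behead (s := x :: s) ys)).
  apply: filterS (filterI nCx IHs) => z [nCxz nCsz] y.
  by rewrite inE => /predU1P[->|/nCsz].
have [N [oN nN NW]] := profinite_open_normal ppG.1 W1.
have [gT [f [hf fE pf]]] := finite_quotient_hom p_pr ppG oN nN.
exists gT, f; split=> // x c xs Cc /esym/fE /NW /(_ x xs); rewrite mulKVg; exact.
Qed.

Definition prod_closed_cycles (G : topologicalGroupType) (s : seq G) : set G :=
  foldr (fun g S => [set x * y | x in closed_cycle g & y in S]) [set 1] s.

Lemma prod_closed_cyclesP (G : topologicalGroupType) (s : seq G) :
  prod_closed_cycles s = [set: G] -> boundedly_generated G.
Proof.
move=> sG; exists (size s), (fun i => nth 1 s i) => x.
have : prod_closed_cycles s x by rewrite sG.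
elim: s x {sG} => [|g s IHs] x /=.
  by move=> ->; exists (fun=> 1) => [[]|] //; rewrite big_ord0.
case=> y gy [z /IHs[h hs ->] <-].
exists (fun i => if unlift ord0 i is Some k then h k else y).
  by move=> i; case: unliftP => [k ->|->] //=; apply: hs.
rewrite big_ord_recl unlift_none; congr (_ * _).
by apply: eq_bigr => i _; rewrite liftK.
Qed.

Lemma compact_mul (G : topologicalGroupType) (A B : set G) :
  compact A -> compact B -> compact [set x * y | x in A & y in B].
Proof.
move=> cA cB.
have -> : [set x * y | x in A & y in B] = (fun xy : G * G => xy.1 * xy.2) @` (A `*` B).
  apply/seteqP; split=> [_ [x Ax [y By <-]]|_ [[x y] [Ax By] <-]]; first by exists (x, y).
  by exists x => //; exists y.
apply: continuous_compact; last exact: compact_setX.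
exact/continuous_subspaceT/mulg_continuous.
Qed.

Lemma compact_prod_closed_cycles (G : topologicalGroupType) (s : seq G) :
  compact [set: G] -> compact (prod_closed_cycles s).
Proof.
move=> cG; elim: s => [|g s IHs] /=; first exact: compact_set1.
apply: compact_mul => //.
exact: subclosed_compact (@closed_closure _ _) cG (subsetT _).
Qed.

Lemma prod_closed_cycles_cat (G : topologicalGroupType) (s t : seq G) :
  prod_closed_cycles (s ++ t) =
    [set x * y | x in prod_closed_cycles s & y in prod_closed_cycles t].
Proof.
elim: s => [|g s IHs] /=.
  apply/seteqP; split=> [x tx|_ [_ -> [x tx <-]]]; last by rewrite mul1g.
  by exists 1 => //; exists x; rewrite ?mul1g.
rewrite IHs; apply/seteqP; split.
  move=> _ [x gx [_ [y sy [z tz <-]] <-]].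
  exists (x * y); first by exists x => //; exists y.
  by exists z; rewrite ?mulgA.
move=> _ [_ [x gx [y sy <-]] [z tz <-]].
exists x => //; exists (y * z); last by rewrite mulgA.
by exists y => //; exists z.
Qed.
End Generation.

(** * The order of the iterated twists *)

Section Growth.
Local Open Scope group_scope.

Lemma leq_expn m n d : m <= n -> (m ^ d <= n ^ d)%N.
Proof. by case: d => // d le_mn; rewrite leq_exp2r. Qed.

Lemma image_set_comp (G : Type) (gT rT : finGroupType) (h : gT -> rT) (f : G -> gT) :
  image_set (h \o f) = h @: image_set f.
Proof.
apply/setP=> y; apply/image_setP/imsetP=> [[x <-]|[_ /image_setP[x <-] ->]].
  by exists (f x); rewrite ?mem_image_set.
by exists x.
Qed.

Lemma finite_hom_post (G : topologicalGroupType) (gT rT : finGroupType)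
    (h : gT -> rT) (f : G -> gT) :
  {morph h : x y / x * y} -> finite_hom f -> finite_hom (h \o f).
Proof.
move=> hM [fM lf]; split; first by move=> x y /=; rewrite fM hM.
move=> y; exact: (@locally_constant_open _ _ f (h @^-1` [set y])%classic lf).
Qed.

Variables (p : nat) (A G1 G2 G : topologicalGroupType).
Variables (i1 : A -> G1) (i2 : A -> G2) (j1 : G1 -> G) (j2 : G2 -> G).
Hypotheses (p_pr : prime p) (po : pro_p_pushout p i1 i2 j1 j2).
Hypotheses (ci1 : continuous_hom i1) (ci2 : continuous_hom i2).

(** A twist does not change the orders c0, c1, c2 of the images of A, G1 and G2. Of the
    image R of G only a multiple e of the exponent and a lower bound n for the order
    are recorded, since these are what a twist controls. *)
Definition amalgam_quotient (c0 c1 c2 e n : nat) : Prop :=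
  exists (gT : finGroupType) (f1 : G1 -> gT) (f2 : G2 -> gT),
  [/\ finite_hom f1, finite_hom f2 & f1 \o i1 = f2 \o i2] /\
  [/\ #|image_set (f1 \o i1)| = c0, #|image_set f1| = c1 & #|image_set f2| = c2] /\
  let R := <<image_set f1 :|: image_set f2>> in
  [/\ p.-group R, forall x, x \in R -> x ^+ e = 1 & n <= #|R|].

Lemma amalgam_quotient_bound d c0 c1 c2 e n :
    (forall (gT : finGroupType) (f : G -> gT), finite_hom f ->
      exists2 s, size s = d & prod_cycles s = image_set f) ->
  0 < e -> amalgam_quotient c0 c1 c2 e n -> n <= e ^ d.
Proof.
move=> bG e_gt0 [gT [f1 [f2 [[hf1 hf2 eqi] [_ [pR Re nR]]]]]].
have [f [hf _ _ imf]] := pushout_finite po hf1 hf2 eqi pR.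
have [s <- defR] := bG gT f hf; rewrite imf in defR.
apply: leq_trans nR _; rewrite -indexg1.
apply: (index_prod_cycles defR) => //; first exact: normal1.
by move=> x /Re ->; apply: set11.
Qed.

(** One twist, with t = #|R : B| - #|R : P1| - #|R : P2|; since a1 + a2 < a1 * a2 this
    is at least the fraction 1 / (a1 * a2 * c0) of the order of R. *)
Lemma amalgam_quotient_step c0 a1 a2 e n :
    0 < c0 -> a1 + a2 < a1 * a2 -> 0 < n ->
    amalgam_quotient c0 (a1 * c0) (a2 * c0) e n ->
  exists t, [/\ 0 < t, n <= t * (a1 * a2 * c0) &
              amalgam_quotient c0 (a1 * c0) (a2 * c0) (p * e) (n * p ^ t)].
Proof.
move=> c0_gt0 lta n_gt0 [gT [f1 [f2 [[hf1 hf2 eqi] [[cB cP1 cP2] [pR Re nR]]]]]].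
have hB := finite_hom_comp hf1 ci1.
pose B := Group (image_group_set hB.1).
pose P1 := Group (image_group_set hf1.1).
pose P2 := Group (image_group_set hf2.1).
pose R := (P1 <*> P2)%G.
have sBP1 : B \subset P1.
  by apply/fintype.subsetP=> _ /image_setP[a <-]; apply: mem_image_set.
have sBP2 : B \subset P2.
  by rewrite /= eqi; apply/fintype.subsetP=> _ /image_setP[a <-]; apply: mem_image_set.
have sP1R : P1 \subset R := joing_subl _ _.
have sP2R : P2 \subset R := joing_subr _ _.
have [rT [h1 [h2 [[h1M h2M h1I h2I eqB] [pR' expR' cardR']]]]] :=
  twisted_amalgam B p_pr (pR : p.-group (P1 <*> P2)).
have idx1 : #|R : B| = (#|R : P1| * a1)%N.
  rewrite -(Lagrange_index sP1R sBP1); congr (_ * _)%N.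
  apply/eqP; rewrite -(eqn_pmul2l (cardG_gt0 B)) Lagrange //.
  by rewrite -[#|P1|]/#|image_set f1| cP1 -[#|B|]/#|image_set (f1 \o i1)| cB mulnC.
have idx2 : #|R : B| = (#|R : P2| * a2)%N.
  rewrite -(Lagrange_index sP2R sBP2); congr (_ * _)%N.
  apply/eqP; rewrite -(eqn_pmul2l (cardG_gt0 B)) Lagrange //.
  by rewrite -[#|P2|]/#|image_set f2| cP2 -[#|B|]/#|image_set (f1 \o i1)| cB mulnC.
have cardR : #|R| = (#|R : B| * c0)%N.
  rewrite mulnC -cB -[#|image_set _|]/#|B| Lagrange //.
  exact: fintype.subset_trans sBP1 sP1R.
have R_gt0 : 0 < #|R : P1| := indexg_gt0 _ _.
set u := #|R : P1| in idx1 cardR' R_gt0; set v := #|R : P2| in idx2 cardR'.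
set w := #|R : B| in idx1 idx2 cardR cardR'.
have w_gt0 : 0 < w := indexg_gt0 _ _.
have eqw : ((u + v) * (a1 * a2) = w * (a1 + a2))%N.
  by rewrite mulnDl mulnDr {2}idx1 {1}idx2; lia.
have le_t : w <= (w - (u + v)) * (a1 * a2).
  by rewrite mulnBl eqw -mulnBr leq_pmulr // subn_gt0.
exists (w - (u + v)); split.
- by case: (w - (u + v)) le_t => //; rewrite mul0n leqNgt w_gt0.
- by apply: leq_trans nR _; rewrite -[X in X <= _]/#|R| cardR mulnA leq_mul2r le_t orbT.
have ltw : u + v <= w.
  rewrite leqNgt; apply: contraL le_t => /ltnW; rewrite -subn_eq0 => /eqP->.
  by rewrite mul0n -ltnNge.
exists rT, (h1 \o f1), (h2 \o f2); split; last split.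
- split; [exact: finite_hom_post | exact: finite_hom_post |].
  apply/funext=> a /=; rewrite eqB; last exact: (mem_image_set (f1 \o i1)).
  by rewrite -[f1 _]/((f1 \o i1) a) eqi.
- rewrite -compA !image_set_comp !card_imset //.
- split.
  + by rewrite !image_set_comp.
  + by move=> x; rewrite !image_set_comp; apply: expR'.
  rewrite !image_set_comp.
  apply: leq_trans (leq_mul nR (leqnn _)) _.
  have puv : 0 < p ^ (u + v) by rewrite expn_gt0 prime_gt0.
  by rewrite -(leq_pmul2r puv) -mulnA -expnD subnK.
Qed.

(** If a1 + a2 < a1 * a2, the twists repeat for ever. After k twists the order is at
    least p^k and the exponent at most p^k e; the next twist multiplies the order by
    p^t with t at least p^k divided by a constant, while the bound by the
    exponent only leaves room for t linear in k. *)
Lemma amalgam_quotient_index d c0 a1 a2 e n :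
    (forall (gT : finGroupType) (f : G -> gT), finite_hom f ->
      exists2 s, size s = d & prod_cycles s = image_set f) ->
  0 < c0 -> 0 < e -> 0 < n -> amalgam_quotient c0 (a1 * c0) (a2 * c0) e n ->
  a1 * a2 <= a1 + a2.
Proof.
move=> bG c0_gt0 e_gt0 n_gt0 st0; rewrite leqNgt; apply/negP => lta.
set S := amalgam_quotient _ _ _ in st0.
have growth k : S (p ^ k * e)%N (p ^ k)%N.
  elim: k => [|k IHk].
    have [gT [f1 [f2 [hf [cf [pR Re nR]]]]]] := st0.
    exists gT, f1, f2; split=> //; split=> //; split=> //.
      by move=> x xR; rewrite expn0 mul1n Re.
    exact: leq_trans n_gt0 nR.
  have [|t [t_gt0 _]] := amalgam_quotient_step c0_gt0 lta _ IHk.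
    by rewrite expn_gt0 prime_gt0.
  case=> gT [f1 [f2 [hf [cf [pR Re nR]]]]].
  exists gT, f1, f2; split=> //; split=> //; split=> //.
    by move=> x /Re; rewrite mulnA -expnS.
  apply: leq_trans nR; rewrite -expnD leq_exp2l ?prime_gt1 //.
  by rewrite -addn1 leq_add2l.
pose c := (a1 * a2 * c0)%N.
have [k lek] := exp2_dominates (d * c) ((e.+1 * d * c).+1)%N.
have [|t [t_gt0 let_ st']] := amalgam_quotient_step c0_gt0 lta _ (growth k).
  by rewrite expn_gt0 prime_gt0.
have pe_gt0 : 0 < p * (p ^ k * e) by rewrite !muln_gt0 expn_gt0 prime_gt0.
have := amalgam_quotient_bound bG pe_gt0 st'.
have le_e : e <= p ^ e by rewrite ltnW // ltn_expl ?prime_gt1.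
have le_pe : p * (p ^ k * e) <= p ^ (k + e.+1).
  by rewrite addnS expnS expnD !leq_mul.
have le_k2 : 2 ^ k <= p ^ k by apply: leq_expn; apply: prime_gt1.
move=> /leq_trans/(_ (leq_expn d le_pe)).
rewrite -expnD -expnM leq_exp2l ?prime_gt1 // => le_kt.
have le_t : t <= (k + e.+1) * d by apply: leq_trans le_kt; apply: leq_addl.
have le_2k : 2 ^ k <= (k + e.+1) * d * c.
  by apply: leq_trans le_k2 (leq_trans let_ _); rewrite leq_mul2r le_t orbT.
have := leq_trans lek le_2k; rewrite addnS ltnNge => /negP; apply.
by rewrite !mulnDl leq_add2r -mulnA mulnC.
Qed.
End Growth.

(** * The indices are two *)

Section IndexTwo.
Local Open Scope group_scope.

Lemma index2_mulVg (gT : finGroupType) (B P : {group gT}) x y :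
  B \subset P -> #|P| = (2 * #|B|)%N -> x \in P -> y \in P -> x \notin B -> y \notin B ->
  x^-1 * y \in B.
Proof.
move=> sBP cP xP yP xB yB; rewrite -mem_lcoset.
have defP : B :|: x *: B = P.
  apply/eqP; rewrite eqEcard finset.subUset sBP cP; apply/andP; split.
    by apply/fintype.subsetP=> z; rewrite mem_lcoset => /(fintype.subsetP sBP) zP;
       rewrite -(mulKVg x z) groupM.
  rewrite cardsU card_lcoset (_ : B :&: x *: B = finset.set0).
    by rewrite cards0 subn0 mul2n addnn.
  apply/setP=> z; rewrite !inE mem_lcoset; apply/negP => /andP[zB xzB].
  by case/negP: xB; rewrite -groupV -(mulgK z x^-1) groupM ?groupV.
by move: yP; rewrite -defP finset.in_setU (negPf yB).
Qed.

Lemma proper_amalgamC (p : nat) (A G1 G2 G : topologicalGroupType)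
    (i1 : A -> G1) (i2 : A -> G2) (j1 : G1 -> G) (j2 : G2 -> G) :
  proper_amalgam p i1 i2 j1 j2 -> proper_amalgam p i2 i1 j2 j1.
Proof.
move=> [[ppA ppG1 ppG2] hi1 hi2 [ppG cj1 cj2 eqj univ] [j1I j2I]].
split=> //; split=> // H f1 f2 ppH cf1 cf2 eqf.
have [f [[cf fj2 fj1] uniq]] := univ H f2 f1 ppH cf2 cf1 (esym eqf).
by exists f; split=> // g [cg gj1 gj2]; apply: uniq.
Qed.

Lemma continuous_range_closed (T U : topologicalType) (f : T -> U) :
  compact [set: T] -> hausdorff_space U -> continuous f -> closed (range f).
Proof.
move=> cT hU cf; apply: compact_closed => //.
by apply: continuous_compact => //; apply: continuous_subspaceT.
Qed.

Variables (p : nat) (A G1 G2 G : topologicalGroupType).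
Variables (i1 : A -> G1) (i2 : A -> G2) (j1 : G1 -> G) (j2 : G2 -> G).
Hypotheses (p_pr : prime p) (amal : proper_amalgam p i1 i2 j1 j2).

(** Both indices are at least 2, and a1 * a2 <= a1 + a2 then leaves only a1 = a2 = 2. *)
Lemma finite_index_two (gT : finGroupType) (f1 : G1 -> gT) (f2 : G2 -> gT) x1 x2 :
  boundedly_generated G -> finite_hom f1 -> finite_hom f2 -> f1 \o i1 = f2 \o i2 ->
  p.-group <<image_set f1 :|: image_set f2>> ->
  f1 x1 \notin image_set (f1 \o i1) -> f2 x2 \notin image_set (f1 \o i1) ->
  p = 2 /\ #|image_set f1| = (2 * #|image_set (f1 \o i1)|)%N.
Proof.
have [_ [ci1 _] [ci2 _] po _] := amal.
move=> bG hf1 hf2 eqi pR fx1 fx2.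
have [d bd] := boundedly_generated_image bG.
have hB := finite_hom_comp hf1 ci1.
pose B := Group (image_group_set hB.1).
pose P1 := Group (image_group_set hf1.1).
pose P2 := Group (image_group_set hf2.1).
have sBP1 : B \subset P1.
  by apply/fintype.subsetP=> _ /image_setP[a <-]; apply: mem_image_set.
have sBP2 : B \subset P2.
  by rewrite /= eqi; apply/fintype.subsetP=> _ /image_setP[a <-]; apply: mem_image_set.
have gt1 : 1 < #|P1 : B|.
  rewrite indexg_gt1; apply/negP => /fintype.subsetP sPB; case/negP: fx1.
  by apply: sPB; apply: mem_image_set.
have gt2 : 1 < #|P2 : B|.
  rewrite indexg_gt1; apply/negP => /fintype.subsetP sPB; case/negP: fx2.
  by apply: sPB; apply: mem_image_set.
have st : amalgam_quotient p i1 i2 #|B| (#|P1 : B| * #|B|) (#|P2 : B| * #|B|)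
             #|<<image_set f1 :|: image_set f2>>| 1.
  exists gT, f1, f2; split=> //; split.
    by rewrite ![(#|_ : _| * _)%N]mulnC !Lagrange.
  split=> //.
  by move=> x; apply: expg_cardG.
have le12 := amalgam_quotient_index p_pr po ci1 bd
  (cardG_gt0 B) (cardG_gt0 _) (ltn0Sn 0) st.
have eq2 : #|P1 : B| = 2.
  move: le12 gt1 gt2; set u := #|_ : _|; set v := #|_ : _|; clearbody u v.
  by nia.
split; last first.
  rewrite -[#|image_set f1|]/#|P1| -[#|image_set (f1 \o i1)|]/#|B|.
  by rewrite -(Lagrange sBP1) eq2 mulnC.
have : p.-nat #|P1 : B|.
  apply: pnat_dvd (dvdn_indexg _ _) _; apply: pgroupS pR.
  by rewrite sub_gen // finset.subsetUl.
by rewrite eq2 pnatE // inE => /eqP.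
Qed.

(** If two elements x and y outside A had x^-1 y outside A, a finite quotient that
    separates these elements from A would show three cosets of the image of A. *)
Lemma index_two : range i1 <> [set: G1]%classic -> range i2 <> [set: G2]%classic ->
  boundedly_generated G -> p = 2 /\ has_index (range i1) 2.
Proof.
have [[ppA ppG1 ppG2] [ci1 i1I] [ci2 i2I] po [j1I j2I]] := amal.
have [ppG cj1 cj2 eqj _] := po.
move=> ne1 ne2 bG.
have [x1 nx1] : exists x1, ~ range i1 x1.
  by apply: contrapT => no; apply: ne1; apply/seteqP; split=> // x _;
     apply: contrapT => nx; apply: no; exists x.
have [x2 nx2] : exists x2, ~ range i2 x2.
  by apply: contrapT => no; apply: ne2; apply/seteqP; split=> // x _;
     apply: contrapT => nx; apply: no; exists x.
pose C := range (j1 \o i1).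
have clC : closed C.
  apply: continuous_range_closed; first by case: ppA => -[].
    by case: ppG => -[].
  by move=> a; apply: continuous_comp; [apply: ci1.2 | apply: cj1.2].
have nC1 x : ~ range i1 x -> ~ C (j1 x).
  by move=> nx [a _ /j1I eqx]; apply: nx; exists a.
have nC2 x : ~ range i2 x -> ~ C (j2 x).
  move=> nx [a _ ] /=; rewrite -[j1 _]/((j1 \o i1) a) eqj => /j2I eqx.
  by apply: nx; exists a.
have sep (s : seq G) : (forall x, x \in s -> ~ C x) -> j1 x1 \in s -> j2 x2 \in s ->
    p = 2 /\ exists (gT : finGroupType) (f : G -> gT), [/\ finite_hom f,
      forall x c, x \in s -> C c -> f c <> f x &
      #|image_set (f \o j1)| = (2 * #|image_set ((f \o j1) \o i1)|)%N].
  move=> nCs s1 s2.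
  have [gT [f [hf pf fs]]] := finite_separation p_pr ppG clC nCs.
  have hf1 := finite_hom_comp hf cj1; have hf2 := finite_hom_comp hf cj2.
  have eqi : (f \o j1) \o i1 = (f \o j2) \o i2.
    by apply/funext=> a /=; rewrite -[j1 _]/((j1 \o i1) a) eqj.
  have pR : p.-group <<image_set (f \o j1) :|: image_set (f \o j2)>>.
    by rewrite -(pushout_image po hf pf).
  have fx1 : (f \o j1) x1 \notin image_set ((f \o j1) \o i1).
    by apply/image_setP => -[a]; apply: fs => //; exists a.
  have fx2 : (f \o j2) x2 \notin image_set ((f \o j1) \o i1).
    by apply/image_setP => -[a]; apply: fs => //; exists a.
  have [-> c2] := finite_index_two bG hf1 hf2 eqi pR fx1 fx2.
  by split=> //; exists gT, f.
have i1M := ci1.1.2; have j1M := cj1.1.2.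
have R1 : range i1 1 by exists 1; rewrite ?ci1.1.1.
have RF a b : range i1 a -> range i1 b -> range i1 (a * b^-1).
  by move=> [u _ <-] [v _ <-]; exists (u * v^-1); rewrite // i1M morph_V.
have RV a : range i1 a -> range i1 a^-1 by move=> /(RF _ _ R1); rewrite mul1g.
have RM a b : range i1 a -> range i1 b -> range i1 (a * b).
  by move=> Ra /RV /(RF _ _ Ra); rewrite invgK.
split.
  have [|||-> _] // := sep [:: j1 x1; j2 x2]; rewrite ?inE ?eqxx ?orbT //.
  by move=> x; rewrite !inE => /orP[/eqP->|/eqP->]; [apply: nC1 | apply: nC2].
have out2 x y : ~ range i1 x -> ~ range i1 y -> range i1 (x^-1 * y).
  move=> nx ny; apply: contrapT => nxy.
  have [|||_ [gT [f [hf fs c2]]]] :=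
    sep [:: j1 x1; j2 x2; j1 x; j1 y; j1 (x^-1 * y)]; rewrite ?inE ?eqxx ?orbT //.
    move=> z; rewrite !inE.
    by case/orP=> [/eqP->|/orP[/eqP->|/orP[/eqP->|/orP[/eqP->|/eqP->]]]]; auto.
  have hf1 := finite_hom_comp hf cj1; have hB := finite_hom_comp hf1 ci1.
  pose B := Group (image_group_set hB.1).
  pose P1 := Group (image_group_set hf1.1).
  have sBP1 : B \subset P1.
    by apply/fintype.subsetP=> _ /image_setP[a <-]; apply: mem_image_set.
  have nB z : j1 z \in [:: j1 x1; j2 x2; j1 x; j1 y; j1 (x^-1 * y)] ->
      (f \o j1) z \notin B.
    by move=> zs; apply/image_setP => -[a]; apply: fs => //; exists a.
  have /negP[] := nB (x^-1 * y) (ltac:(by rewrite !inE eqxx !orbT)).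
  rewrite hf1.1 morph_V; last exact: hf1.1.
  apply: (index2_mulVg sBP1 c2); rewrite ?mem_image_set //.
    by apply: nB; rewrite !inE eqxx !orbT.
  by apply: nB; rewrite !inE eqxx !orbT.
apply/(has_indexP 2 R1 RF).
exists (fun x => if `[< range i1 x >] then ord0 else ord_max); split.
  case=> -[|[|//]] lt_i; [exists 1 | exists x1]; apply: val_inj => /=.
    by rewrite asboolT.
  by rewrite asboolF.
move=> x y; case: asboolP => Rx; case: asboolP => Ry; split=> //.
- by move=> _; apply: RM => //; apply: RV.
- by move=> Rxy; case: Ry; rewrite -(mulKVg x y); apply: RM.
- move=> Rxy; case: Rx; rewrite -(mulKVg y x); apply: RM => //.
  by have := RV _ Rxy; rewrite invMg invgK.
- by move=> _; apply: out2.
Qed.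
End IndexTwo.

(** * Closed subgroups of boundedly generated pro-2 groups *)

Section ClosedSubgroup.
Local Open Scope group_scope.
Local Open Scope classical_set_scope.

Lemma open_normalI (G : topologicalGroupType) (N N' : set G) :
  open N /\ normal_subgroup N -> open N' /\ normal_subgroup N' ->
  open (N `&` N') /\ normal_subgroup (N `&` N').
Proof.
move=> [oN /normal_subgroupP[N1 NF NJ]] [oN' /normal_subgroupP[N1' NF' NJ']].
split; first exact: openI.
apply/normal_subgroupP; split=> //.
  by move=> x y [Nx Nx'] [Ny Ny']; split; [apply: NF | apply: NF'].
by move=> x y [Nx Nx']; split; [apply: NJ | apply: NJ'].
Qed.

Lemma prod_cycles_exp (gT : finGroupType) (t : seq gT) D y :
    y \in prod_cycles t -> (size t <= D)%N ->
  exists n : 'I_D -> nat, y = \prod_(i < D) (nth 1 t i) ^+ n i.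
Proof.
elim: t D y => [|g t IHt] D y.
  rewrite /prod_cycles big_nil => /set1P -> _; exists (fun=> 0).
  by rewrite big1.
rewrite prod_cycles_cons => /mulsgP[_ z /cycleP[k ->] /IHt zt ->].
case: D => // D /zt[n ->].
exists (fun i => if unlift ord0 i is Some i' then n i' else k).
rewrite big_ord_recl unlift_none; congr (_ * _).
by apply: eq_bigr => i _; rewrite liftK.
Qed.

(** For each open normal N of G some D-tuple of A generates A modulo N, in the sense of
    products of powers. These sets of tuples form a filter base on the compact
    space A^D, and being determined modulo N they contain every cluster point. *)
Lemma closed_subgroup_boundedly_generated (A G : topologicalGroupType) (j : A -> G) :
    pro_p 2 A -> pro_p 2 G -> continuous_hom j -> injective j ->
  boundedly_generated G -> boundedly_generated A.
Proof.
move=> ppA ppG hj jI bG; have [[j1 jM] cj] := hj.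
have [d bd] := boundedly_generated_image bG.
have [D subD] := subgroup_prod_cycles d.
pose X (N : set G) (a : 'I_D -> A) := forall x : A, exists n : 'I_D -> nat,
  N ((j x)^-1 * \prod_(i < D) j (a i) ^+ n i).
have cA : compact [set: A] by case: ppA => -[].
have hG : hausdorff_space G by case: ppG => -[].
have X_nonempty N : open N -> normal_subgroup N -> exists a, X N a.
  move=> oN nN; have [gT [f [hf fE pf]]] := finite_quotient_hom (isT : prime 2) ppG oN nN.
  have [s szs defs] := bd gT f hf.
  have hfj := finite_hom_comp hf hj.
  have [|t szt deft] := subD gT (Group (image_group_set hf.1))
      (Group (image_group_set hfj.1)) s pf defs (eq_leq szs).
    by apply/fintype.subsetP=> _ /image_setP[x <-]; apply: mem_image_set.
  have tE i : exists x, f (j x) = nth 1 t i.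
    have [lt_i|le_i] := ltnP i (size t); last first.
      by exists 1; rewrite nth_default // j1 (morph_1 hf.1).
    have : nth 1 t i \in image_set (f \o j).
      by rewrite -[image_set _]deft mem_prod_cycles // mem_nth.
    by case/image_setP=> x <-; exists x.
  pose a (i : 'I_D) := projT1 (cid (tE i)).
  have fa i : f (j (a i)) = nth 1 t i by rewrite /a; case: cid.
  exists a => x.
  have fx : f (j x) \in prod_cycles t by rewrite deft; apply: (mem_image_set (f \o j)).
  suff [n eqx] : exists n : 'I_D -> nat, f (j x) = \prod_(i < D) f (j (a i)) ^+ n i.
    exists n; apply/fE; rewrite eqx (big_morph f hf.1 (morph_1 hf.1)).
    by apply: eq_bigr => i _; rewrite (morph_X _ _ hf.1).
  have [n eqx] := prod_cycles_exp fx szt; exists n.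
  by rewrite eqx; apply: eq_bigr => i _; rewrite fa.
pose Ix := [set N : set G | open N /\ normal_subgroup N].
pose F := filter_from Ix X.
have FF : ProperFilter F.
  apply: filter_from_proper; last by move=> N [oN nN]; apply: X_nonempty.
  apply: filter_from_filter.
    exists setT; split; first exact: openT.
    by apply/normal_subgroupP.
  move=> N N' NI NI'; exists (N `&` N'); first exact: open_normalI.
  by move=> a Xa; split=> x; have [n [Nn N'n]] := Xa x; exists n.
have cAD := @tychonoff 'I_D (fun=> A) (fun=> setT) (fun=> cA).
have [|a [_ cla]] := cAD F FF; first by apply: filterS filterT.
have XaN N : Ix N -> X N a.
  move=> NI; have [oN nN] := NI.
  have [gT [f [hf fE pf]]] := finite_quotient_hom (isT : prime 2) ppG oN nN.
  have near_a : nbhs a [set a' : 'I_D -> A | forall i, f (j (a' i)) = f (j (a i))].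
    apply: (@filter_forall _ 'I_D
      (fun i => [set a' : 'I_D -> A | f (j (a' i)) = f (j (a i))]) (nbhs a)) => i.
    have oi := (finite_hom_comp hf hj).2 (f (j (a i))).
    have ai : nbhs (a i) ((f \o j) @^-1` [set f (j (a i))]).
      exact: (open_nbhs_nbhs (conj oi erefl)).
    exact: (@proj_continuous 'I_D (fun=> A) i a _ ai).
  have [|b [Xb eqb]] := cla (X N) _ _ near_a; first by exists N.
  move=> x; have [n /fE eqx] := Xb x; exists n; apply/fE; rewrite eqx.
  rewrite !(big_morph f hf.1 (morph_1 hf.1)).
  by apply: eq_bigr => i _; rewrite !(morph_X _ _ hf.1) eqb.
apply: (@prod_closed_cyclesP _ [seq a i | i <- index_enum 'I_D]).
apply/seteqP; split=> // x _; apply: contrapT => nx.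
pose C := j @` prod_closed_cycles [seq a i | i <- index_enum 'I_D].
have clC : closed C.
  apply: compact_closed => //; apply: continuous_compact.
    exact: continuous_subspaceT.
  exact: compact_prod_closed_cycles.
have nCx : ~ C (j x) by move=> [y Cy /jI eqy]; apply: nx; rewrite -eqy.
have W1 : nbhs 1 ((fun z => j x * z) @^-1` (~` C)).
  have : j x * z @[z --> (1 : G)] --> j x * 1.
    by apply: mulg_cvg; [apply: cvg_cst | apply: cvg_id].
  by apply; rewrite mulg1; apply: open_nbhs_nbhs; split=> //; apply: closed_openC.
have [N [oN nN NW]] := profinite_open_normal ppG.1 W1.
have [n /NW /=] := XaN N (conj oN nN) x; rewrite mulKVg; apply.
exists (\prod_(i < D) a i ^+ n i); last first.
  rewrite (big_morph j jM j1); apply: eq_bigr => i _.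
  by rewrite (morph_X _ _ jM).
have -> : \prod_(i < D) a i ^+ n i = \prod_(i <- index_enum 'I_D) a i ^+ n i by [].
elim: (index_enum 'I_D) => [|i r IHr]; first by rewrite big_nil.
rewrite big_cons; exists (a i ^+ n i); first by apply: subset_closure; exists (n i); left.
by exists (\prod_(k <- r) a k ^+ n k).
Qed.
End ClosedSubgroup.

(** * Amalgams along subgroups of index two *)

Section IndexTwoGeneration.
Local Open Scope group_scope.

(** Modulo B, x and y are involutions, so x inverts x y and normalizes the group
    <[x * y]> B; adjoining x to it gives everything. *)
Lemma gen_two_index2_sub (gT : finGroupType) (B : {group gT}) (P1 P2 : {set gT}) x y :
    x \in 'N(B) -> y \in 'N(B) -> x * x \in B -> y * y \in B ->
    (forall z, z \in P1 -> z \in B \/ x^-1 * z \in B) ->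
    (forall z, z \in P2 -> z \in B \/ y^-1 * z \in B) ->
  <<P1 :|: P2>> \subset <[x * y]> * B * <[x]>.
Proof.
move=> nx ny xx yy P1B P2B; set N := (<[x * y]> <*> B)%G.
have defN : N = <[x * y]> * B :> {set gT}.
  by rewrite /N /= norm_joinEl // cycle_subG groupM.
have sBN : B \subset N := joing_subr _ _.
have xyN : x * y \in N by rewrite -cycle_subG joing_subl.
have nNx : x \in 'N(N).
  rewrite inE /N /= conjYg join_subG -cycleJ cycle_subG; apply/andP; split.
    have -> : (x * y) ^ x = (y * y) * ((x * y)^-1 * (x * x)).
      by rewrite conjgE invMg !mulgA mulgK mulVg mul1g mulgVK.
    rewrite groupM ?(fintype.subsetP sBN _ yy) // groupM ?groupV //.
    exact: (fintype.subsetP sBN _ xx).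
  by have -> : B :^ x = B by [apply/normP]; apply: joing_subr.
have defNx : N <*> <[x]> = <[x * y]> * B * <[x]>.
  by rewrite norm_joinEr ?cycle_subG // defN.
rewrite -defNx; set M := (N <*> <[x]>)%G.
have sNM : N \subset M := joing_subl _ _.
have sBM : B \subset M := fintype.subset_trans sBN sNM.
have xM : x \in M by rewrite -cycle_subG joing_subr.
have yM : y \in M by rewrite -(mulKg x y) groupM ?groupV // (fintype.subsetP sNM).
rewrite gen_subG finset.subUset; apply/andP; split; apply/fintype.subsetP=> z.
  case/P1B=> zB; first exact: (fintype.subsetP sBM).
  by rewrite -(mulKVg x z) groupM // (fintype.subsetP sBM).
case/P2B=> zB; first exact: (fintype.subsetP sBM).
by rewrite -(mulKVg y z) groupM // (fintype.subsetP sBM).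
Qed.

Lemma morph_J (G H : groupType) (f : G -> H) x y :
  {morph f : x y / x * y} -> f (x ^ y) = f x ^ f y.
Proof. by move=> fM; rewrite !conjgE !fM (morph_V _ fM). Qed.

Local Open Scope classical_set_scope.

Lemma boundedly_generated_prod (G : topologicalGroupType) :
  boundedly_generated G -> exists s : seq G, prod_closed_cycles s = [set: G].
Proof.
move=> [d [g bG]]; exists [seq g i | i <- index_enum 'I_d].
apply/seteqP; split=> // x _; have [h hg ->] := bG x.
elim: (index_enum 'I_d) => [|i r IHr]; first by rewrite big_nil.
by rewrite big_cons; exists (h i) => //; exists (\prod_(k <- r) h k).
Qed.

Lemma closed_cycle_image (A G : topologicalGroupType) (j : A -> G) g x :
  continuous_hom j -> closed_cycle g x -> closed_cycle (j g) (j x).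
Proof.
move=> [[j1 jM] cj] gx W Wjx.
have [y [[n eqy] Wy]] := gx _ (cj x W Wjx).
exists (j y); split=> //; exists n.
by case: eqy => ->; [left | right]; rewrite ?(morph_V _ jM) (morph_X _ _ jM).
Qed.

Lemma prod_closed_cycles_image (A G : topologicalGroupType) (j : A -> G) s x :
  continuous_hom j -> prod_closed_cycles s x -> prod_closed_cycles (map j s) (j x).
Proof.
move=> hj; elim: s x => [|g s IHs] x /=; first by move=> ->; rewrite hj.1.1.
case=> y gy [z sz <-]; rewrite hj.1.2; exists (j y); first exact: closed_cycle_image.
by exists (j z) => //; apply: IHs.
Qed.

Lemma index_two_out (G : topologicalGroupType) (N : set G) :
    N 1 -> (forall a b, N a -> N b -> N (a * b^-1)) -> has_index N 2 ->
  forall x y, ~ N x -> ~ N y -> N (x^-1 * y).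
Proof.
move=> N1 NF /(has_indexP _ N1 NF)[idx [_ idxE]] x y nNx nNy.
have idx1 z : ~ N z -> idx z != idx 1.
  move=> nNz; apply/eqP=> /esym/idxE; rewrite invg1 mul1g.
  exact: nNz.
apply/idxE; move: (idx1 x nNx) (idx1 y nNy).
case: (idx x) (idx y) (idx 1) => [[|[|//]] ?] [[|[|//]] ?] [[|[|//]] ?] //= *;
  exact: val_inj.
Qed.

(** Modulo A the group G is generated by two involutions. The product of closed
    cycles taken here is cl<g1 g2> A cl<g1>; it is closed, and every finite
    quotient of G is covered by it. *)
Lemma amalgam_boundedly_generated (p : nat) (A G1 G2 G : topologicalGroupType)
    (i1 : A -> G1) (i2 : A -> G2) (j1 : G1 -> G) (j2 : G2 -> G) :
    prime p -> proper_amalgam p i1 i2 j1 j2 ->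
    range i1 <> [set: G1] -> range i2 <> [set: G2] ->
    has_index (range i1) 2 -> has_index (range i2) 2 ->
  boundedly_generated A -> boundedly_generated G.
Proof.
move=> p_pr [[ppA ppG1 ppG2] [ci1 i1I] [ci2 i2I] po _] ne1 ne2 ind1 ind2 bA.
have [ppG cj1 cj2 eqj _] := po.
have side (H : topologicalGroupType) (i : A -> H) : continuous_hom i ->
    range i <> [set: H] -> has_index (range i) 2 -> exists x,
    [/\ range i (x * x), forall a, range i ((i a) ^ x) &
        forall z, range i z \/ range i (x^-1 * z)].
  move=> [[i_1 iM] _] ne ind.
  have [x nx] : exists x, ~ range i x.
    by apply: contrapT => no; apply: ne; apply/seteqP; split=> // x _;
       apply: contrapT => nx; apply: no; exists x.
  have R1 : range i 1 by exists 1.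
  have RF a b : range i a -> range i b -> range i (a * b^-1).
    by move=> [u _ <-] [v _ <-]; exists (u * v^-1); rewrite // iM morph_V.
  have RV a : range i a -> range i a^-1 by move=> /(RF _ _ R1); rewrite mul1g.
  have out := index_two_out R1 RF ind.
  exists x; split.
  - have nxV : ~ range i x^-1 by move/RV; rewrite invgK.
    by have := out _ _ nxV nx; rewrite invgK.
  - move=> a; rewrite conjgE; apply: out => // Rax; apply: nx.
    have := RF _ _ (RV _ Rax) (RV (i a) _).
    by rewrite invMg !invgK mulgVK => /(_ (ex_intro2 _ _ a I erefl)) /RV; rewrite invgK.
  move=> z; have [Rz|nRz] := pselect (range i z); [by left | right].
  exact: out.
have [x1 [xx1 nx1 out1]] := side _ i1 ci1 ne1 ind1.
have [x2 [xx2 nx2 out2]] := side _ i2 ci2 ne2 ind2.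
have [s sA] := boundedly_generated_prod bA.
pose j := j1 \o i1.
have hj : continuous_hom j := continuous_hom_comp ci1 cj1.
pose t := (j1 x1 * j2 x2) :: map j s ++ [:: j1 x1].
apply: (@prod_closed_cyclesP _ t); apply/seteqP; split=> // x _.
apply: contrapT => nx.
have clt : closed (prod_closed_cycles t).
  apply: compact_closed; first by case: ppG => -[].
  by apply: compact_prod_closed_cycles; case: ppG => -[].
have [|gT [f [hf pf fs]]] := finite_separation (s := [:: x]) p_pr ppG clt.
  by move=> z; rewrite inE => /eqP ->.
have hB := finite_hom_comp hf hj.
pose B := Group (image_group_set hB.1).
have jE2 a : j1 (i1 a) = j2 (i2 a) by rewrite -[j1 _]/((j1 \o i1) a) eqj.
have B1 z : range i1 z -> f (j1 z) \in B.
  by case=> a _ <-; apply: (mem_image_set (f \o j)).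
have B2 z : range i2 z -> f (j2 z) \in B.
  by case=> a _ <-; rewrite -jE2; apply: (mem_image_set (f \o j)).
have hf1 := finite_hom_comp hf cj1; have hf2 := finite_hom_comp hf cj2.
have : f x \in image_set f := mem_image_set f x.
rewrite (pushout_image po hf pf).
have inP : <<image_set (f \o j1) :|: image_set (f \o j2)>> \subset
    cycle (f (j1 x1) * f (j2 x2)) * B * cycle (f (j1 x1)).
  apply: gen_two_index2_sub.
  - rewrite inE; apply/fintype.subsetP=> _ /imsetP[_ /image_setP[a <-] ->].
    by have := B1 _ (nx1 a); rewrite -[f _]/((f \o j1) _) (morph_J _ _ hf1.1).
  - rewrite inE; apply/fintype.subsetP=> _ /imsetP[_ /image_setP[a <-] ->].
    have := B2 _ (nx2 a); rewrite -[f _]/((f \o j2) _) (morph_J _ _ hf2.1) /= -jE2.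
    exact.
  - by have := B1 _ xx1; rewrite -[f _]/((f \o j1) _) hf1.1.
  - by have := B2 _ xx2; rewrite -[f _]/((f \o j2) _) hf2.1.
  - move=> _ /image_setP[z <-]; have [/B1|/B1] := out1 z; [by left | right].
    by rewrite -(morph_V _ hf1.1) -hf1.1.
  - move=> _ /image_setP[z <-]; have [/B2|/B2] := out2 z; [by left | right].
    by rewrite -(morph_V _ hf2.1) -hf2.1.
move/(fintype.subsetP inP).
move=> /mulsgP[_ _ /mulsgP[_ _ /cycleP[m ->] /image_setP[a <-] ->] /cycleP[n ->] eqx].
pose c := (j1 x1 * j2 x2) ^+ m * j a * j1 x1 ^+ n.
have : f c = f x by rewrite eqx /c !hf.1 !(morph_X _ _ hf.1) hf.1.
apply: fs; first by rewrite inE.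
exists ((j1 x1 * j2 x2) ^+ m); first by apply: subset_closure; exists m; left.
exists (j a * j1 x1 ^+ n); last by rewrite mulgA.
rewrite -/(prod_closed_cycles _) prod_closed_cycles_cat.
exists (j a); first by apply: prod_closed_cycles_image => //; rewrite sA.
exists (j1 x1 ^+ n) => //=; exists (j1 x1 ^+ n).
  by apply: subset_closure; exists n; left.
by exists 1; rewrite ?mulg1.
Qed.
End IndexTwoGeneration.

Local Open Scope classical_set_scope.

Theorem theorem1 (p : nat) (A G1 G2 G : topologicalGroupType)
    (i1 : A -> G1) (i2 : A -> G2) (j1 : G1 -> G) (j2 : G2 -> G)
    (p_prime : prime p)
    (G_amalgam : proper_amalgam p i1 i2 j1 j2)
    (A_neq_G1 : range i1 <> [set: G1])
    (A_neq_G2 : range i2 <> [set: G2]) :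
  boundedly_generated G <->
  boundedly_generated A /\
    [/\ p = 2%N, has_index (range i1) 2 & has_index (range i2) 2].
Proof.
split=> [bG | [bA [_ ind1 ind2]]]; last first.
  exact: amalgam_boundedly_generated p_prime G_amalgam A_neq_G1 A_neq_G2 ind1 ind2 bA.
have [p2 ind1] := index_two p_prime G_amalgam A_neq_G1 A_neq_G2 bG.
have [_ ind2] := index_two p_prime (proper_amalgamC G_amalgam) A_neq_G2 A_neq_G1 bG.
split=> //; have [[ppA _ _] [ci1 i1I] _ [ppG cj1 _ _ _] [j1I _]] := G_amalgam.
rewrite p2 in ppA ppG.
apply: (closed_subgroup_boundedly_generated ppA ppG _ _ bG (j := j1 \o i1)).
  exact: continuous_hom_comp.
exact: inj_comp.
Qed.
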